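(* Let $I$ be a compact interval, $\beta>1$, and let $f:I\to\mathcal{K}_c(\mathbb{R})$ be continuous with $\dim_H\mathcal{G}_*(f)\ge\beta$. Then there exist $g_*,h_*\in\mathcal{D}_\beta$ such that $f=g_*\oplus h_*$, where $\mathcal{D}_\beta=\{g\in\mathcal{C}(I,\mathcal{K}_c(\mathbb{R})):\dim_H\mathcal{G}_*(g)=\beta\}$.
   Context: $\mathcal{K}_c(\mathbb{R})$: non-empty compact convex subsets of $\mathbb{R}$; $\mathcal{C}(I,\mathcal{K}_c(\mathbb{R}))$: continuous maps $I\to\mathcal{K}_c(\mathbb{R})$ with respect to the Hausdorff distance $\mathfrak{H}$. $(g\oplus h)(x)=g(x)\oplus h(x)$ where $A\oplus B=\{a+b:(a,b)\in\Lambda(A,B)\}$, $\Lambda(A,B)=\{(a,b)\in A\times B:a\in\Lambda_A(b)\text{ or }b\in\Lambda_B(a)\}$, $\Lambda_A(b)=\{a\in A:|b-a|=\min_{a'\in A}|b-a'|\}$. $\mathcal{G}_*(g)=\{(x,g(x)):x\in I\}$ with metric $d((x,Y),(y,Z))=|x-y|+\mathfrak{H}(Y,Z)$; $\dim_H$ is Hausdorff dimension. *)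

(* Defs.v *)
From HB Require Import structures.
From mathcomp Require Import all_boot all_order all_algebra.
From mathcomp Require Import all_classical all_reals all_analysis.
Set Implicit Arguments. Unset Strict Implicit. Unset Printing Implicit Defensive.
Import Order.TTheory GRing.Theory Num.Theory.
Import numFieldNormedType.Exports.
Local Open Scope classical_set_scope.
Local Open Scope ring_scope.

Section Defs.
Variable R : realType.

Definition Kc (A : set R) : Prop :=
  A !=set0 /\ compact A /\
  (forall x y z, A x -> A y -> x <= z -> z <= y -> A z).

Definition excess (A B : set R) : R :=
  sup [set inf [set `|a - b| | b in B] | a in A].
Definition hdist (A B : set R) : R := Num.max (excess A B) (excess B A).

Definition Lam1 (A : set R) (b : R) : set R :=
  [set a | A a /\ forall a', A a' -> `|b - a| <= `|b - a'|].
Definition Lam (A B : set R) : set (R * R) :=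
  [set p | A p.1 /\ B p.2 /\ (Lam1 A p.2 p.1 \/ Lam1 B p.1 p.2)].
Definition oplus (A B : set R) : set R := [set p.1 + p.2 | p in Lam A B].

Definition CK (a b : R) (g : R -> set R) : Prop :=
  (forall x, a <= x <= b -> Kc (g x)) /\
  (forall x, a <= x <= b -> forall e, 0 < e -> exists2 d, 0 < d &
     forall y, a <= y <= b -> `|x - y| < d -> hdist (g x) (g y) < e).

Definition graphK (a b : R) (g : R -> set R) : set (R * set R) :=
  [set (x, g x) | x in [set x | a <= x <= b]].
Definition gdist (p q : R * set R) : R := `|p.1 - q.1| + hdist p.2 q.2.

Section Hdim.
Variables (X : Type) (d : X -> X -> R).

Definition diamR (U : set X) : R :=
  sup ([set 0] `|` [set d x y | x in U & y in U]).

Definition dcover (delta : R) (E : set X) (U : nat -> set X) : Prop :=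
  E `<=` \bigcup_n U n /\ forall n x y, U n x -> U n y -> d x y <= delta.

Definition Hcontent (s delta : R) (E : set X) : \bar R :=
  ereal_inf [set (\sum_(0 <= n <oo) ((powR (diamR (U n)) s)%:E))%E
            | U in dcover delta E].

Definition Hmeasure (s : R) (E : set X) : \bar R :=
  ereal_sup [set Hcontent s delta E | delta in [set delta : R | 0 < delta]].

Definition hdim (E : set X) : \bar R :=
  ereal_inf [set s%:E | s in [set s : R | 0 < s /\ Hmeasure s E = 0%E]].
End Hdim.

Definition dimG (a b : R) (g : R -> set R) : \bar R :=
  hdim gdist (graphK a b g).

Definition Dbeta (a b beta : R) (g : R -> set R) : Prop :=
  CK a b g /\ dimG a b g = beta%:E.
End Defs.

(* Main.v *)
(** Writing a set-valued map with values in [Kc] as the pair (lower endpoint,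
    length), the metric sum becomes the pointwise sum of pairs, so [f] has to be
    split into two summands with nonnegative lengths whose graphs both have
    dimension [beta].

    First split [f = w + z] so that both graphs have dimension 1: Lipschitz
    approximations of [f] from below are assigned alternately to [w] and [z],
    and at the [n]-th step the next approximation is chosen so close to [f] that
    one summand is, up to an error smaller than any power of [1 / L], an
    [L]-Lipschitz map.

    Let [k = 1] if [beta <= 2] and [k = 2] otherwise, and [s = beta - k], which
    lies in (0, 1] because graphs of maps into R^k have dimension at most
    [k + 1]. Take a Cantor set [D] of dimension [s] in which rare digits of [x]
    encode [k] real numbers [Y x]; the graph of [Y] over [D] (and over each of
    its two halves) has dimension [s + k = beta] since the density-one
    remaining digits of [x] and the values [Y x] are independent. Any graph
    over [D] with [k] arbitrary coordinates has dimension at most [beta].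
    Now add to [w], and subtract from [z], a correction that makes [w] equal to
    [Y] on one half of [D] and [z] equal to [Y] on the other half (up to affine
    changes of variable), and which is locally Lipschitz off [D], so that it does
    not change the dimensions of the graphs there. *)

Require Import Defs.
From HB Require Import structures.
From mathcomp Require Import all_boot all_order all_algebra.
From mathcomp Require Import all_classical all_reals all_analysis.
From mathcomp Require Import zify ring lra.
Set Implicit Arguments. Unset Strict Implicit. Unset Printing Implicit Defensive.
Import Order.TTheory GRing.Theory Num.Theory.
Import numFieldNormedType.Exports.
Local Open Scope classical_set_scope.
Local Open Scope ring_scope.

(** * Compact intervals: Hausdorff distance and metric sum *)

Section IntervalSets.
Variable R : realType.
Implicit Types (a b c d x y z e : R) (A B : set R).

Definition seg a b : set R := [set z | a <= z <= b].

Lemma norm_inf_le A (y c : R) : A c -> inf [set `|y - z| | z in A] <= `|y - c|.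
Proof.
move=> Ac; apply: ge_inf; last by exists c.
by exists 0 => _ [z _ <-].
Qed.

Lemma le_norm_inf A (y c : R) : A !=set0 -> (forall z, A z -> c <= `|y - z|) ->
  c <= inf [set `|y - z| | z in A].
Proof.
move=> [z0 Az0] h; apply: lb_le_inf; first by exists `|y - z0|; exists z0.
by move=> _ [z Az <-]; exact: h.
Qed.

Lemma excess_le A B e : A !=set0 ->
  (forall x, A x -> exists2 y, B y & `|x - y| <= e) -> excess A B <= e.
Proof.
move=> [x0 Ax0] h; apply: ge_sup; first by eexists; exists x0.
move=> _ [x Ax <-]; have [y By xy] := h _ Ax.
exact: le_trans (norm_inf_le _ By) xy.
Qed.

(** The nearness hypothesis bounds the set of distances from above, which makes its [sup] comparable
    with its elements. *)
Lemma le_excess A B e x c : B !=set0 ->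
  (forall x, A x -> exists2 y, B y & `|x - y| <= e) ->
  A x -> (forall y, B y -> c <= `|x - y|) -> c <= excess A B.
Proof.
move=> B0 h Ax cB; apply: (@le_trans _ _ (inf [set `|x - z| | z in B])).
  exact: le_norm_inf.
apply: ub_le_sup; last by exists x.
exists e => _ [z Az <-]; have [y By zy] := h _ Az.
exact: le_trans (norm_inf_le _ By) zy.
Qed.

Lemma seg_near a b c d e x : a <= b -> c <= d -> `|a - c| <= e -> `|b - d| <= e ->
  seg a b x -> exists2 y, seg c d y & `|x - y| <= e.
Proof.
rewrite /seg /= => ab cd ac bd /andP[ax xb].
move: ac bd; rewrite !ler_norml => /andP[? ?] /andP[? ?].
have [xc|cx] := leP x c.
  by exists c; [lra|rewrite ler_norml; lra].
have [dx|xd] := leP d x.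
  by exists d; [lra|rewrite ler_norml; lra].
by exists x; [lra|rewrite ler_norml; lra].
Qed.

Lemma seg0 a b : a <= b -> seg a b !=set0.
Proof. by move=> ab; exists a; rewrite /seg /= lexx. Qed.

Lemma hdist_seg_le a b c d e : a <= b -> c <= d ->
  `|a - c| <= e -> `|b - d| <= e -> hdist (seg a b) (seg c d) <= e.
Proof.
move=> ab cd ac bd; rewrite /hdist ge_max; apply/andP; split.
  by apply: excess_le; [exact: seg0|move=> x; exact: seg_near].
by apply: excess_le; [exact: seg0|move=> x; apply: seg_near; rewrite // distrC].
Qed.

(** The smaller of the two lower endpoints is at distance at least [|a - c|] from every point of the
    other interval, so one of the two excesses detects it; upper endpoints are symmetric. With
    [hdist_seg_le], [hdist] is the larger endpoint difference. *)
Lemma le_hdist_seg a b c d : a <= b -> c <= d ->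
  `|a - c| <= hdist (seg a b) (seg c d) /\ `|b - d| <= hdist (seg a b) (seg c d).
Proof.
move=> ab cd.
pose e := Num.max `|a - c| `|b - d|.
have ac : `|a - c| <= e by rewrite le_max lexx.
have bd : `|b - d| <= e by rewrite le_max lexx orbT.
have h1 x : seg a b x -> exists2 y, seg c d y & `|x - y| <= e by exact: seg_near.
have h2 x : seg c d x -> exists2 y, seg a b y & `|x - y| <= e.
  by apply: seg_near; rewrite // distrC.
have sub z t : z <= `|z - t| + t by have := ler_norm (z - t); lra.
have sub' z t : z - t <= `|t - z| by have := ler_norm (z - t); rewrite distrC; lra.
rewrite /hdist; split; rewrite le_max; apply/orP.
- have [lac|lca] := leP a c.
  + left; apply: (@le_excess _ _ e a) => //; first exact: seg0.
      by rewrite /seg /= lexx.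
    move=> y /andP[cy yd]; rewrite ler0_norm; last by lra.
    by apply: le_trans (sub' y a); lra.
  + right; apply: (@le_excess _ _ e c) => //; first exact: seg0.
      by rewrite /seg /= lexx.
    move=> y /andP[cy yd]; rewrite gtr0_norm; last by lra.
    by apply: le_trans (sub' y c); lra.
- have [lac|lca] := leP b d.
  + right; apply: (@le_excess _ _ e d) => //; first exact: seg0.
      by rewrite /seg /= lexx andbT.
    move=> y /andP[cy yd]; rewrite ler0_norm; last by lra.
    by apply: le_trans (ler_norm _); lra.
  + left; apply: (@le_excess _ _ e b) => //; first exact: seg0.
      by rewrite /seg /= lexx andbT.
    move=> y /andP[cy yd]; rewrite gtr0_norm; last by lra.
    by apply: le_trans (ler_norm _); lra.
Qed.

Lemma seg_Kc a b : a <= b -> Kc (seg a b).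
Proof.
move=> ab; split; first exact: seg0.
split; last by move=> x y z /andP[? ?] /andP[? ?] ? ?; rewrite /seg /=; lra.
have -> : seg a b = `[a, b]%classic by apply/seteqP; split => x /=; rewrite in_itv.
exact: segment_compact.
Qed.

Lemma Kc_seg A : Kc A -> exists a b, a <= b /\ A = seg a b.
Proof.
move=> [A0 [cA convA]].
have cid : {within A, continuous (@id R)} by apply: continuous_subspaceT => x.
have [M AM hM] := compact_EVT_max A0 cA cid.
have [m Am hm] := compact_EVT_min A0 cA cid.
rewrite inE in AM; rewrite inE in Am.
exists m, M; split; first by apply: hM; rewrite inE.
apply/seteqP; split => x.
  by move=> Ax; rewrite /seg /= hm ?hM ?inE.
by move=> /andP[? ?]; apply: (convA m M).
Qed.

(* The metric sum of two intervals is their Minkowski sum: pairing every point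
   of one interval with its projection onto the other sweeps out two
   overlapping intervals whose union is everything. *)
Lemma oplus_seg a b c d : a <= b -> c <= d ->
  oplus (seg a b) (seg c d) = seg (a + c) (b + d).
Proof.
move=> ab cd; apply/seteqP; split => z.
  by case=> -[p q] /= [/= /andP[? ?] [/= /andP[? ?] _]] <-; rewrite /seg /=; lra.
rewrite /seg /= => /andP[z1 z2].
have proj l u p q : l <= q <= u -> (q = p \/ (p < q /\ q = l) \/ (q < p /\ q = u)) ->
    Lam1 (seg l u) p q.
  move=> lqu h; split => // t /andP[lt tu].
  case: h => [->|[[pq ql]|[qp qu]]]; first by rewrite subrr normr0.
  - by rewrite ler0_norm ?ler0_norm; lra.
  - by rewrite gtr0_norm ?gtr0_norm; lra.
suff [p [q [pq zpq]]] : exists p q : R, Lam (seg a b) (seg c d) (p, q) /\ p + q = z.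
  by exists (p, q).
have mk1 p q : a <= p <= b -> c <= q <= d ->
    (p = q \/ (q < p /\ p = a) \/ (p < q /\ p = b)) ->
    Lam (seg a b) (seg c d) (p, q).
  by move=> ? ? ?; split => //; split => //; left; apply: proj.
have mk2 p q : a <= p <= b -> c <= q <= d ->
    (q = p \/ (p < q /\ q = c) \/ (q < p /\ q = d)) ->
    Lam (seg a b) (seg c d) (p, q).
  by move=> ? ? ?; split => //; split => //; right; apply: proj.
(* If [z / 2] lies in both intervals it is used twice; otherwise one summand is pinned at an
   endpoint. *)
have [h1|h1] := boolP ((Num.max a c <= z / 2) && (z / 2 <= Num.min b d)).
  move: h1; rewrite ge_max le_min => /andP[/andP[? ?] /andP[? ?]].
  exists (z / 2), (z / 2); split; last by lra.
  by apply: mk1; [lra|lra|left].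
have [ac|ca] := leP a c.
- have [zac|zac] := leP (z / 2) c.
    have [zb|zb] := leP (z - c) b.
      exists (z - c), c; split; last by lra.
      apply: mk2; [lra|lra|].
      have [e|ne] := eqVneq c (z - c); first by left.
      by right; left; split => //; rewrite lt_neqAle eq_sym ne; lra.
    exists b, (z - b); split; last by lra.
    by apply: mk1; [lra|lra|right; right; split => //; lra].
  have zbd : Num.min b d < z / 2.
    by rewrite ltNge; apply: contra h1 => ->; rewrite andbT ge_max; lra.
  move: zbd; rewrite gt_min => /orP[zb|zd].
    have [zd|zd] := leP (z - b) d.
      exists b, (z - b); split; last by lra.
      by apply: mk1; [lra|lra|right; right; split => //; lra].
    by exfalso; lra.
  have [zb|zb] := leP (z - d) b.
    exists (z - d), d; split; last by lra.
    by apply: mk2; [lra|lra|right; right; split => //; lra].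
  by exfalso; lra.
- have [zac|zac] := leP (z / 2) a.
    have [zd|zd] := leP (z - a) d.
      exists a, (z - a); split; last by lra.
      apply: mk1; [lra|lra|].
      have [e|ne] := eqVneq a (z - a); first by left.
      by right; left; split => //; rewrite lt_neqAle eq_sym ne; lra.
    exists (z - d), d; split; last by lra.
    by apply: mk2; [lra|lra|right; right; split => //; lra].
  have zbd : Num.min b d < z / 2.
    by rewrite ltNge; apply: contra h1 => ->; rewrite andbT ge_max; lra.
  move: zbd; rewrite gt_min => /orP[zb|zd].
    have [zd|zd] := leP (z - b) d.
      exists b, (z - b); split; last by lra.
      by apply: mk1; [lra|lra|right; right; split => //; lra].
    by exfalso; lra.
  have [zb|zb] := leP (z - d) b.
    exists (z - d), d; split; last by lra.
    by apply: mk2; [lra|lra|right; right; split => //; lra].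
  by exfalso; lra.
Qed.

End IntervalSets.

(** * Hausdorff null sets through covers *)

Section HausdorffNull.
Variables (R : realType) (X : Type) (d : X -> X -> R).
Implicit Types (E : set X) (U : nat -> set X) (s t e : R).

Lemma nneseries_le_partial (u : nat -> R) e : (forall n, 0 <= u n) ->
  (forall N, \sum_(n < N) u n <= e) ->
  (\sum_(0 <= n <oo) (u n)%:E <= e%:E)%E.
Proof.
move=> u0 h; apply: lime_le.
  by apply: is_cvg_nneseries => n _ _; rewrite lee_fin.
by apply: nearW => N; rewrite sumEFin lee_fin big_mkord; exact: h.
Qed.

(** Measure zero unfolded into covers, the form in which it is proved and refuted below. *)
Definition null_cover s E := forall delta e, 0 < delta -> 0 < e ->
  exists2 U, dcover d delta E U &
    (\sum_(0 <= n <oo) (powR (diamR d (U n)) s)%:E <= e%:E)%E.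

Lemma series_diam_ge0 s U :
  (0 <= \sum_(0 <= n <oo) (powR (diamR d (U n)) s)%:E)%E.
Proof. by apply: nneseries_ge0 => n _ _; rewrite lee_fin powR_ge0. Qed.

Lemma Hcontent_ge0 s delta E : (0 <= Hcontent d s delta E)%E.
Proof.
by apply: le_ereal_inf_tmp => _ [U _ <-]; exact: series_diam_ge0.
Qed.

Lemma Hmeasure0P s E : Hmeasure d s E = 0%E <-> null_cover s E.
Proof.
split=> [H0 delta e d0 e0|H].
  have : (Hcontent d s delta E < e%:E)%E.
    apply: (@le_lt_trans _ _ 0%E); last by rewrite lte_fin.
    by rewrite -H0; apply: ereal_sup_ubound; exists delta.
  by move=> /ereal_inf_lt[_ [U cU <-] /ltW ?]; exists U.
apply/eqP; rewrite eq_le; apply/andP; split.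
  apply: ge_ereal_sup => _ [delta d0 <-].
  apply/lee_addgt0Pr => e e0; rewrite add0e.
  have [U cU hU] := H _ _ d0 e0.
  by apply: ge_ereal_inf; exists (\sum_(0 <= n <oo) (powR (diamR d (U n)) s)%:E)%E => //; exists U.
apply: le_trans (ereal_sup_ubound _); last by exists 1; [exact: ltr01|reflexivity].
exact: Hcontent_ge0.
Qed.

Lemma null_coverS s E1 E2 : E1 `<=` E2 -> null_cover s E2 -> null_cover s E1.
Proof.
move=> sE N delta e d0 e0; have [U [cU dU] hU] := N _ _ d0 e0.
by exists U => //; split => //; exact: subset_trans cU.
Qed.

(** The [m]-th set gets the budget [e / 2 ^ (m + 1)], and a bijection of [nat] with [nat * nat]
    merges the covers into one sequence. *)
Lemma null_cover_bigcup s (E : nat -> set X) :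
  (forall m, null_cover s (E m)) -> null_cover s (\bigcup_m E m).
Proof.
move=> N delta e d0 e0.
have h m : {U | dcover d delta (E m) U /\
    (\sum_(0 <= n <oo) (powR (diamR d (U n)) s)%:E <= (e / (2 ^ m.+1)%:R)%:E)%E}.
  apply: cid; have [||U ? ?] := N m delta (e / (2 ^ m.+1)%:R) => //.
    by rewrite divr_gt0// ltr0n expn_gt0.
  by exists U.
pose U m := sval (h m).
have /card_set_bijP[f bf] : ([set: nat] #= [set: nat * nat])%card.
  by rewrite card_eq_sym card_nat2.
exists (fun n => U (f n).1 (f n).2).
  split.
    move=> x [m _ Emx]; have [[cU _] _] := svalP (h m).
    have [k _ Ukx] := cU _ Emx.
    have [_ _ /(_ (m, k))[//|n _ fn]] := bf.
    by exists n => //; rewrite fn.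
  move=> n x y Ux Uy; have [[_ dU] _] := svalP (h (f n).1).
  exact: dU Ux Uy.
rewrite nneseries_esumT; last by move=> n; rewrite lee_fin powR_ge0.
rewrite -(@reindex_esum _ _ _ setT setT f
  (fun p => (powR (diamR d (U p.1 p.2)) s)%:E)) //.
rewrite (_ : [set: nat * nat] = [set: nat] `*`` (fun _ => [set: nat])); last first.
  by apply/seteqP; split => x.
rewrite -(@esum_esum _ _ _ _ _ (fun m k => (powR (diamR d (U m k)) s)%:E)); last first.
  by move=> *; rewrite lee_fin powR_ge0.
rewrite -nneseries_esumT; last first.
  by move=> n; apply: esum_ge0 => *; rewrite lee_fin powR_ge0.
apply: (@le_trans _ _ (\sum_(0 <= m <oo) (0 + (e / (2 ^ m.+1)%:R)%:E))%E).
  apply: lee_nneseries.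
    by move=> n _ _; apply: esum_ge0 => *; rewrite lee_fin powR_ge0.
  move=> n _; rewrite add0e -nneseries_esumT; last by move=> *; rewrite lee_fin powR_ge0.
  by have [_] := svalP (h n).
apply: le_trans (epsilon_trick _ _ _) _ => //; first exact: ltW.
by rewrite eseries0 // add0e.
Qed.

Lemma diamR_le (U0 : set X) r : 0 <= r -> (forall x y, U0 x -> U0 y -> d x y <= r) ->
  diamR d U0 <= r.
Proof.
move=> r0 h; apply: ge_sup; first by exists 0; left.
by move=> _ [->//|[x Ux [y Uy <-]]]; exact: h.
Qed.

Lemma le_diamR (U0 : set X) r x y : (forall x y, U0 x -> U0 y -> d x y <= r) ->
  U0 x -> U0 y -> d x y <= diamR d U0.
Proof.
move=> h Ux Uy; apply: ub_le_sup; last by right; exists x => //; exists y.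
exists (Num.max 0 r) => _ [->|[x' Ux' [y' Uy' <-]]]; rewrite le_max ?lexx//.
by rewrite h ?orbT.
Qed.

Lemma diamR_ge0 (U0 : set X) r : (forall x y, U0 x -> U0 y -> d x y <= r) ->
  0 <= diamR d U0.
Proof.
move=> h; apply: ub_le_sup; last by left.
exists (Num.max 0 r) => _ [->|[x' Ux' [y' Uy' <-]]]; rewrite le_max ?lexx//.
by rewrite h ?orbT.
Qed.

(** For upper bounds on dimension it is enough to count boxes of a single size. *)
Lemma null_cover_finite s E : 0 < s ->
  (forall e, 0 < e -> exists r (T : finType) (U : T -> set X),
    [/\ 0 < r < e, E `<=` \bigcup_i U i,
      (forall i x y, U i x -> U i y -> d x y <= r) & #|T|%:R * powR r s <= e]) ->
  null_cover s E.
Proof.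
move=> s0 h delta e d0 e0.
have [|r [T [U [/andP[r0 re] EU dU cU]]]] := h (Num.min delta e).
  by rewrite lt_min d0.
move: re cU; rewrite lt_min le_min => /andP[rd re] /andP[_ cU].
(* The finite cover is padded with empty sets, which have diameter 0 and contribute nothing since
   [0 < s]. *)
pose V n : set X := [set x | exists2 i : T, enum_rank i = n :> nat & U i x].
have dV n x y : V n x -> V n y -> d x y <= r.
  move=> [i ni Ux] [j nj Uy]; apply: dU Ux _.
  by rewrite (_ : i = j)//; apply/enum_rank_inj/val_inj; rewrite /= ni nj.
exists V.
  split; last by move=> n x y ? ?; apply: le_trans (dV n _ _ _ _) (ltW rd).
  by move=> x /EU[i _ Ux]; exists (enum_rank i) => //; exists i.
apply: nneseries_le_partial => [n|N]; first exact: powR_ge0.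
apply: le_trans cU.
have hV n : powR (diamR d (V n)) s <= if (n < #|T|)%N then powR r s else 0.
  case: ifP => nT.
    apply: ge0_ler_powR; rewrite ?nnegrE; first exact: ltW.
    - exact: diamR_ge0 (dV n).
    - exact: ltW.
    - by apply: diamR_le (dV n); exact: ltW.
  have -> : V n = set0.
    apply/seteqP; split => // x [i ni _].
    by have := ltn_ord (enum_rank i); rewrite ni nT.
  rewrite (_ : diamR d set0 = 0) ?powR0 ?gt_eqF//.
  apply/eqP; rewrite eq_le diamR_le//=.
  exact: (@diamR_ge0 set0 0).
apply: (@le_trans _ _ (\sum_(n < N) if (n < #|T|)%N then powR r s else 0)).
  by apply: ler_sum => i _; exact: hV.
have -> : \sum_(n < N) (if (n < #|T|)%N then powR r s else 0) =
    (minn N #|T|)%:R * powR r s.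
  elim: N => [|N IH]; first by rewrite big_ord0 min0n mul0r.
  rewrite big_ord_recr /= IH; case: ltnP => NT.
    by rewrite !(minn_idPl _) ?(ltnW NT)// -[in RHS]natr1 mulrDl mul1r.
  by rewrite addr0 !(minn_idPr _) // ltnW.
by rewrite ler_wpM2r ?powR_ge0// ler_nat geq_minr.
Qed.

End HausdorffNull.

(** * Volume obstruction to economical covers *)

Section CubeCovers.
Variable R : realType.

Lemma lebesgue_measure_seg (c l : R) : 0 <= l ->
  lebesgue_measure `[c - l, c + l]%classic = (2 * l)%:E.
Proof.
move=> l0; rewrite lebesgue_measure_itv /= lte_fin.
case: ltP => h; first by rewrite -EFinB; congr EFin; ring.
by congr EFin; lra.
Qed.

(** This is countable subadditivity of Lebesgue measure in dimension 3; the factor 8 turns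
    half-sides into sides. *)
Lemma cube_cover (c1 c2 c3 l1 l2 l3 : nat -> R) :
  (forall n, 0 <= l1 n) -> (forall n, 0 <= l2 n) -> (forall n, 0 <= l3 n) ->
  (forall y1 y2 y3 : R, 0 <= y1 <= 1 -> 0 <= y2 <= 1 -> 0 <= y3 <= 1 ->
    exists n, [/\ `|y1 - c1 n| <= l1 n, `|y2 - c2 n| <= l2 n &
      `|y3 - c3 n| <= l3 n]) ->
  (1 <= \sum_(0 <= n <oo) (8 * (l1 n * l2 n * l3 n))%:E)%E.
Proof.
move=> l1_ge0 l2_ge0 l3_ge0 cov.
pose lam := @lebesgue_measure R.
pose mu := ((lam \x lam) \x lam)%E.
pose I (c l : R) : set R := `[c - l, c + l]%classic.
have mI c l : measurable (I c l) by exact: measurable_itv.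
have muI c d e l m n : 0 <= l -> 0 <= m -> 0 <= n ->
    mu ((I c l `*` I d m) `*` I e n) = (8 * (l * m * n))%:E.
  move=> ? ? ?; rewrite /mu product_measure1E; [|by apply: measurableX; exact: mI|exact: mI].
  rewrite [X in (X * _)%E]product_measure1E; [|exact: mI|exact: mI].
  rewrite [X in (X * _ * _)%E]lebesgue_measure_seg //.
  rewrite [X in (_ * X * _)%E]lebesgue_measure_seg // [X in (_ * X)%E]lebesgue_measure_seg //.
  by rewrite -!EFinM; congr EFin; ring.
pose h : R := 1 / 2.
have h0 : 0 <= h by rewrite /h; lra.
have Ih y : I h h y -> 0 <= y <= 1 by rewrite /I /= in_itv /= /h => /andP[? ?]; lra.
have -> : 1%E = mu ((I h h `*` I h h) `*` I h h).
  by rewrite muI //; congr EFin; rewrite /h; lra.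
have -> : (\sum_(0 <= n <oo) (8 * (l1 n * l2 n * l3 n))%:E)%E =
   (\sum_(0 <= n <oo) mu ((I (c1 n) (l1 n) `*` I (c2 n) (l2 n)) `*` I (c3 n) (l3 n)))%E.
  by apply: eq_eseriesr => n _; rewrite muI.
have := @measure_sigma_subadditive _ _ _ ((lam \x lam) \x lam)%E.
apply => [n||].
- by apply: measurableX; [apply: measurableX; exact: mI|exact: mI].
- by apply: measurableX; [apply: measurableX; exact: mI|exact: mI].
- move=> [[y1 y2] y3] /= [[/Ih h1 /Ih h2] /Ih h3].
  have [n [a1 a2 a3]] := cov _ _ _ h1 h2 h3.
  by exists n => //; split; [split|]; rewrite /I /= in_itv /= -ler_distl.
Qed.

(** A set of diameter [rho] meets only parameters in a box of volume at most a constant times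
    [rho ^ (h1 + h2 + h3)], because each parameter is a Hoelder function of the point. A cover with
    small [t]-sum would thus contradict [cube_cover]. *)
Lemma not_null_cover_cube (X : Type) (d : X -> X -> R) (E : set X)
    (P : R -> R -> R -> X) (K h1 h2 h3 t : R) :
  0 < K -> 0 <= h1 -> 0 <= h2 -> 0 <= h3 -> 0 < t <= h1 + h2 + h3 ->
  (forall y1 y2 y3, 0 <= y1 <= 1 -> 0 <= y2 <= 1 -> 0 <= y3 <= 1 -> E (P y1 y2 y3)) ->
  (forall y1 y2 y3 z1 z2 z3, 0 <= y1 <= 1 -> 0 <= y2 <= 1 -> 0 <= y3 <= 1 ->
     0 <= z1 <= 1 -> 0 <= z2 <= 1 -> 0 <= z3 <= 1 ->
     let r := d (P y1 y2 y3) (P z1 z2 z3) in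
     0 <= r /\ [/\ `|y1 - z1| <= K * powR r h1, `|y2 - z2| <= K * powR r h2 &
       `|y3 - z3| <= K * powR r h3]) ->
  ~ null_cover d t E.
Proof.
move=> K0 h1_ge0 h2_ge0 h3_ge0 /andP[t0 th] EP hP N.
(* With this [e] the boxes have total volume at most 1/2. Mesh 1 keeps the diameters at most 1, so
   that the exponent may be lowered to [t]. *)
pose e := (16 * K ^+ 3)^-1.
have e0 : 0 < e by rewrite invr_gt0 mulr_gt0 // exprn_gt0.
have [U [cU dU] sU] := N 1 e ltr01 e0.
pose in3 (y : R * R * R) := [/\ 0 <= y.1.1 <= 1, 0 <= y.1.2 <= 1 & 0 <= y.2 <= 1].
pose Q n (y : R * R * R) := in3 y /\ U n (P y.1.1 y.1.2 y.2).
(* A parameter landing in [U n] serves as centre of the box; when there is none, no parameter has to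
   be covered by that box. *)
pose q n := xget (0, 0, 0) (Q n).
pose rho n := diamR d (U n).
have rho0 n : 0 <= rho n by exact: diamR_ge0 (dU n).
have rho1 n : rho n <= 1 by apply: diamR_le (dU n).
have bound n y : Q n y -> [/\ `|y.1.1 - (q n).1.1| <= K * powR (rho n) h1,
    `|y.1.2 - (q n).1.2| <= K * powR (rho n) h2 &
    `|y.2 - (q n).2| <= K * powR (rho n) h3].
  move=> Qy; have Qq : Q n (q n) by exact: (xgetPex _ (ex_intro _ _ Qy)).
  move: Qy Qq => [[? ? ?] Uy] [[? ? ?] Uq].
  have [|||||| r0 [b1 b2 b3]] := hP y.1.1 y.1.2 y.2 (q n).1.1 (q n).1.2 (q n).2 => //.
  have rr := le_diamR (dU n) Uy Uq.
  have mono k : 0 <= k -> powR (d (P y.1.1 y.1.2 y.2) (P (q n).1.1 (q n).1.2 (q n).2)) k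
      <= powR (rho n) k by move=> k0; apply: ge0_ler_powR; rewrite ?nnegrE.
  split; [apply: le_trans b1 _|apply: le_trans b2 _|apply: le_trans b3 _];
    (apply: ler_wpM2l; [exact: ltW|exact: mono]).
have : (1 <= \sum_(0 <= n <oo)
    (8 * ((K * powR (rho n) h1) * (K * powR (rho n) h2) * (K * powR (rho n) h3)))%:E)%E.
  apply: (@cube_cover (fun n => (q n).1.1) (fun n => (q n).1.2) (fun n => (q n).2)).
  - by move=> n; rewrite mulr_ge0 ?powR_ge0 ?ltW.
  - by move=> n; rewrite mulr_ge0 ?powR_ge0 ?ltW.
  - by move=> n; rewrite mulr_ge0 ?powR_ge0 ?ltW.
  move=> y1 y2 y3 i1 i2 i3; have [n _ Un] := cU _ (EP _ _ _ i1 i2 i3).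
  by exists n; apply: (bound n (y1, y2, y3)).
apply/negP; rewrite -ltNge.
apply: (@le_lt_trans _ _ (\sum_(0 <= n <oo) ((8 * K ^+ 3)%:E * (powR (rho n) t)%:E))%E).
  apply: lee_nneseries => n _.
    by move=> _; rewrite lee_fin !mulr_ge0 ?powR_ge0 ?ltW.
  rewrite -EFinM lee_fin.
  have -> : 8 * ((K * powR (rho n) h1) * (K * powR (rho n) h2) * (K * powR (rho n) h3))
     = 8 * K ^+ 3 * (powR (rho n) h1 * powR (rho n) h2 * powR (rho n) h3) by ring.
  apply: ler_wpM2l; first by rewrite mulr_ge0 // exprn_ge0 // ltW.
  (* As [powR 0 0 = 1], diameter 0 needs a nonzero exponent, and [0 < t] provides one. *)
  have [r0|rn0] := eqVneq (rho n) 0.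
    suff -> : powR (rho n) h1 * powR (rho n) h2 * powR (rho n) h3 = 0 by rewrite powR_ge0.
    rewrite r0; have [e1|/powR0->] := eqVneq h1 0; last by rewrite !mul0r.
    have [e2|/powR0->] := eqVneq h2 0; last by rewrite mulr0 mul0r.
    have [e3|/powR0->] := eqVneq h3 0; last by rewrite mulr0.
    by move: th; rewrite e1 e2 e3; lra.
  have rp : 0 < rho n by rewrite lt_neqAle eq_sym rn0 rho0.
  rewrite -!powRD ?rn0 ?implybT//.
  by apply: ger_powR => //; rewrite rp rho1.
rewrite nneseriesZl; last by move=> n _; rewrite lee_fin powR_ge0.
apply: (@le_lt_trans _ _ ((8 * K ^+ 3)%:E * e%:E)%E).
  by apply: lee_wpmul2l => //; rewrite lee_fin mulr_ge0 // exprn_ge0 // ltW.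
rewrite -EFinM lte_fin /e.
have := exprn_gt0 3 K0; move: (K ^+ 3) => k k0.
by rewrite invfM; have := mulfV (lt0r_neq0 k0); lra.
Qed.

End CubeCovers.

(** * Lipschitz approximation from below *)

Section LipschitzApproximation.
Variable R : realType.
Implicit Types (a b d x y z e L M : R) (F G P Q : R -> R).

Definition cont_on a b F := forall x, a <= x <= b -> forall e, 0 < e ->
  exists2 d : R, 0 < d & forall y, a <= y <= b -> `|x - y| < d -> `|F x - F y| < e.

Definition lip L F := forall x y, `|F x - F y| <= L * `|x - y|.

(** Compactness as passage from local to uniform, with [d] as a scale; uniform continuity and
    boundedness are instances. *)
Lemma near_covering_seg (P : R -> R -> Prop) a b :
  (forall d d' x, 0 < d -> d <= d' -> P d' x -> P d x) ->
  (forall x, a <= x <= b -> exists2 d : R, 0 < d & forall y, `|x - y| < d -> P d y) ->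
  exists2 d : R, 0 < d & forall x, a <= x <= b -> P d x.
Proof.
move=> mono h.
have near0 (d : R) : 0 < d -> \forall t \near 0^'+, 0 < t <= d.
  move=> d0; near=> t; apply/andP; split => //.
  by near: t; apply: nbhs_right_le.
have /compact_near_coveringP/(_ R 0^'+ P _) H := @segment_compact R a b.
have {}H : \forall d \near 0^'+, `[a, b]%classic `<=` P d.
  apply: H.
  move=> x; rewrite /= in_itv /= => /h[d d0 hd].
  exists ([set y : R | `|x - y| < d], [set t : R | 0 < t <= d]) => /=.
    by split; [exists d|exact: near0].
  by move=> [y t] /= [xy /andP[t0 td]]; apply: mono (hd _ xy).
have [d [hd /andP[d0 _]]] := @filter_ex R (0^'+)%classic _ _ (filterI H (near0 1 ltr01)).
by exists d => // x xab; apply: hd; rewrite /= in_itv.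
Unshelve. all: by end_near. Qed.

Lemma cont_on_unif a b F e : cont_on a b F -> 0 < e -> exists2 d : R, 0 < d &
  forall x y, a <= x <= b -> a <= y <= b -> `|x - y| < d -> `|F x - F y| < e.
Proof.
move=> cF e0.
have [d d' x d0 dd' h xab y yab xy|x xab|d d0 h] :=
    @near_covering_seg (fun d x => a <= x <= b -> forall y, a <= y <= b ->
    `|x - y| < d -> `|F x - F y| < e) a b.
- by apply: h => //; apply: lt_le_trans dd'.
- have e20 : 0 < e / 2 by rewrite divr_gt0.
  have [d d0 hd] := cF _ xab _ e20.
  exists (d / 2); first by rewrite divr_gt0.
  move=> y xy yab z zab yz.
  have h1 : `|F x - F y| < e / 2 by apply: hd => //; lra.
  have h2 : `|F x - F z| < e / 2.
    by apply: hd => //; apply: le_lt_trans (ler_distD y _ _) _; lra.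
  by apply: le_lt_trans (ler_distD (F x) _ _) _; rewrite (distrC (F y)); lra.
- by exists d => // x y xab yab; apply: h.
Qed.

Lemma cont_on_bounded a b F : cont_on a b F ->
  exists2 M, 0 < M & forall x, a <= x <= b -> `|F x| <= M.
Proof.
move=> cF.
(* The scale [d] encodes the bound [d^-1], so a smaller scale is a weaker bound. *)
have [d d' x d0 dd' h xab|x xab|d d0 h] :=
  @near_covering_seg (fun d x => a <= x <= b -> `|F x| <= d^-1) a b.
- apply: le_trans (h xab) _.
  by rewrite lef_pV2 // posrE (lt_le_trans d0).
- have [d d0 hd] := cF _ xab 1 ltr01.
  pose M := `|F x| + 1.
  have M0 : 0 < M by rewrite ltr_wpDl.
  exists (Num.min d M^-1); first by rewrite lt_min d0 invr_gt0.
  move=> y; rewrite lt_min => /andP[xy _] yab.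
  apply: (@le_trans _ _ M).
    have := hd _ yab xy; have := ler_normB (F x) (F x - F y).
    by rewrite opprB addrCA subrr addr0 /M => h1 /ltW h2; lra.
  have m0 : 0 < Num.min d M^-1 by rewrite lt_min d0 invr_gt0.
  have mM : Num.min d M^-1 <= M^-1 by rewrite ge_min lexx orbT.
  by rewrite -[leLHS]invrK lef_pV2 ?posrE ?invr_gt0.
- by exists d^-1 => [|x xab]; [rewrite invr_gt0|exact: h].
Qed.

Lemma normr_max_sub x y z t : `|Num.max x y - Num.max z t| <= Num.max `|x - z| `|y - t|.
Proof.
have h1 := ler_norm (x - z); have h2 := ler_norm (z - x); rewrite distrC in h2.
have h3 := ler_norm (y - t); have h4 := ler_norm (t - y); rewrite distrC in h4.
have p1 : `|x - z| <= Num.max `|x - z| `|y - t| by rewrite le_max lexx.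
have p2 : `|y - t| <= Num.max `|x - z| `|y - t| by rewrite le_max lexx orbT.
move: (Num.max `|x - z| _) p1 p2 => M p1 p2.
by rewrite ler_norml; case: (leP x y) => ?; case: (leP z t) => ?; lra.
Qed.

Lemma lip_max L L' F G : 0 <= L -> 0 <= L' -> lip L F -> lip L' G ->
  lip (L + L') (fun x => Num.max (F x) (G x)).
Proof.
move=> L0 L0' hF hG x y; apply: le_trans (normr_max_sub _ _ _ _) _.
have := mulr_ge0 L0 (normr_ge0 (x - y)); have := mulr_ge0 L0' (normr_ge0 (x - y)).
by have := hF x y; have := hG x y; rewrite ge_max mulrDl; lra.
Qed.

(** [P] is the maximum of [Q] and the inf-convolution of [F] with slope [2 * M / d]: points farther
    than [d] are too expensive to lower the infimum below [F x], and nearer ones lower it by less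
    than [e]. *)
Lemma lip_approx a b F Q LQ e : a <= b -> cont_on a b F -> 0 < e ->
  0 <= LQ -> lip LQ Q -> (forall x, a <= x <= b -> Q x <= F x) ->
  exists L P, [/\ 0 <= L, lip L P &
    forall x, a <= x <= b -> Q x <= P x <= F x /\ F x <= P x + e].
Proof.
move=> ab cF e0 LQ0 lQ QF.
have [M M0 hM] := cont_on_bounded cF.
have [d d0 hd] := cont_on_unif cF e0.
pose L := 2 * M / d.
have L0 : 0 <= L by rewrite ltW // divr_gt0 // mulr_gt0.
pose S x : set R := [set F y + L * `|x - y| | y in seg a b].
have S0 x : S x !=set0 by exists (F a + L * `|x - a|), a => //; rewrite /seg /= lexx.
have Slb x : has_lbound (S x).
  exists (- M) => _ [y yab <-]; have := hM y yab; rewrite ler_norml => /andP[? _].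
  by rewrite ler_wpDr // mulr_ge0.
pose P x := inf (S x).
have PF x : a <= x <= b -> P x <= F x.
  by move=> xab; apply: ge_inf => //; exists x => //; rewrite subrr normr0 mulr0 addr0.
have FP x : a <= x <= b -> F x <= P x + e.
  move=> xab; rewrite -lerBlDr; apply: lb_le_inf => // _ [y yab <-].
  have [xy|xy] := ltP `|x - y| d.
    have := hd _ _ xab yab xy; rewrite ltr_norml => /andP[_ h].
    by have := mulr_ge0 L0 (normr_ge0 (x - y)); lra.
  have : 2 * M <= L * `|x - y|.
    by rewrite -[leLHS](@divfK _ d) ?gt_eqF // ler_wpM2l.
  by have := hM y yab; have := hM x xab; rewrite !ler_norml => /andP[? ?] /andP[? ?]; lra.
have lP : lip L P.
  have one x y : P x - L * `|x - y| <= P y.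
    apply: lb_le_inf => // _ [z zab <-].
    have : P x <= F z + L * `|x - z| by apply: ge_inf => //; exists z.
    have := ler_wpM2l L0 (ler_distD y x z); rewrite mulrDr; lra.
  move=> x y; have := one x y; have := one y x; rewrite (distrC y x) ler_norml; lra.
exists (LQ + L), (fun x => Num.max (Q x) (P x)); split; first exact: addr_ge0.
  exact: lip_max.
move=> x xab; split; first by rewrite le_max lexx /= ge_max QF // PF.
by apply: le_trans (FP _ xab) _; rewrite lerD2r le_max lexx orbT.
Qed.

End LipschitzApproximation.

(** * Alternating splitting into two summands *)

Section AlternatingDecomposition.
Variable R : realType.
Implicit Types (a b x y L : R) (S : set R) (g w z F Q G : bool -> R -> R).

(** With [B = L + n + 2] this scale is [B ^ -(n + 1)], so a factor [B] costs only the power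
    [-1 / (n + 1)] of the scale. *)
Definition rad L (n : nat) : R := (L + n%:R + 2)^-1 ^+ n.+1.

Lemma rad_gt0 L n : 0 <= L -> 0 < rad L n.
Proof. by move=> L0; rewrite exprn_gt0 // invr_gt0 ltr_wpDl // addr_ge0. Qed.

(** Only the sum of constant and index enters the base, so a larger index makes up for a smaller
    constant. *)
Lemma le_rad L L' m n : 0 <= L -> 0 <= L' -> L + m%:R <= L' + n%:R ->
  (m <= n)%N -> rad L' n <= rad L m.
Proof.
move=> L0 L'0 h mn; rewrite /rad.
have p1 : 0 < L + m%:R + 2 by rewrite ltr_wpDl // addr_ge0.
have p2 : 0 < L' + n%:R + 2 by rewrite ltr_wpDl // addr_ge0.
apply: (@le_trans _ _ ((L + m%:R + 2)^-1 ^+ n.+1)).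
  apply: lerXn2r; rewrite ?nnegrE ?invr_ge0 ?(ltW p1) ?(ltW p2) // lef_pV2 ?posrE //; lra.
apply: ler_wiXn2l; rewrite ?ltnS ?invr_ge0 ?(ltW p1) // invf_le1 //.
by have := ler0n R m; lra.
Qed.

(* The coordinates not marked [rough] are, on [S], within [rad L n] of
   [L]-Lipschitz functions, a distance smaller than any fixed power of [1 / L]. *)
Definition good_on S (rough : bool -> bool) g := forall n, exists L G,
  0 <= L /\ forall i, ~~ rough i ->
    (forall x y, S x -> S y -> `|G i x - G i y| <= L * `|x - y|) /\
    (forall x, S x -> `|g i x - G i x| <= rad L n).

(** [A] and [B] are the current minorants of the two summands; [A] is the one to be raised next. *)
Record stage a b F Q := Stage {
  stage_n : nat; stage_L : R; stage_A : bool -> R -> R; stage_B : bool -> R -> R;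
  stage_L0 : 0 <= stage_L;
  stage_lA : forall i, lip stage_L (stage_A i);
  stage_lB : forall i, lip stage_L (stage_B i);
  stage_le : forall i x, a <= x <= b ->
    [/\ Q i x / 2 <= stage_A i x, Q i x / 2 <= stage_B i x &
      stage_A i x + stage_B i x <= F i x] }.

(** A Lipschitz [P] between [A + B] and [F] is split as [B + (P - B)]: [B] is kept and [A] grows to
    [P - B]. The error [rad L n] is fixed when only the constant [L] of [B] is known, so [B] is
    pinned down to a precision tiny relative to [L], whatever the constant of [P]. *)
Lemma stage_next a b F Q (s : stage a b F Q) : a <= b ->
  (forall i, cont_on a b (F i)) ->
  {s' : stage a b F Q | [/\ stage_n s' = (stage_n s).+1, stage_A s' = stage_B s &
    forall i x, a <= x <= b -> stage_A s i x <= stage_B s' i x /\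
      F i x <= stage_B s i x + stage_B s' i x + rad (stage_L s) (stage_n s)]}.
Proof.
case: s => n L A B L0 lA lB sle ab cF; apply: cid => /=.
have r0 := rad_gt0 n L0.
have lAB i : lip (L + L) (fun x => A i x + B i x).
  move=> x y; rewrite opprD addrACA; apply: le_trans (ler_normD _ _) _.
  rewrite mulrDl; apply: lerD; [exact: lA|exact: lB].
have h i : exists p : R * (R -> R), [/\ 0 <= p.1, lip p.1 p.2 &
    forall x, a <= x <= b -> A i x + B i x <= p.2 x <= F i x /\
      F i x <= p.2 x + rad L n].
  have AF x : a <= x <= b -> A i x + B i x <= F i x by move=> /(sle i)[].
  have [L' [P [? ? ?]]] := lip_approx ab (cF i) r0 (addr_ge0 L0 L0) (lAB i) AF.
  by exists (L', P).
pose p i := sval (cid (h i)).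
have hp i : [/\ 0 <= (p i).1, lip (p i).1 (p i).2 &
    forall x, a <= x <= b -> A i x + B i x <= (p i).2 x <= F i x /\
      F i x <= (p i).2 x + rad L n] by exact: (svalP (cid (h i))).
pose L' := L + (p true).1 + (p false).1.
have [pt0 _ _] := hp true; have [pf0 _ _] := hp false.
have lip_mono (K K' : R) (H : R -> R) : K <= K' -> lip K H -> lip K' H.
  by move=> KK hG x y; apply: le_trans (hG _ _) _; rewrite ler_wpM2r.
have L'0 : 0 <= L' by rewrite !addr_ge0.
have lB' i : lip L' (B i) by apply: lip_mono (lB i); rewrite /L'; lra.
have lC i : lip L' (fun x => (p i).2 x - B i x).
  have [_ lp _] := hp i; move=> x y.
  rewrite opprD addrACA opprK [- B i x + _]addrC; apply: le_trans (ler_normD _ _) _.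
  apply: (@le_trans _ _ (((p i).1 + L) * `|x - y|)).
    by rewrite mulrDl; apply: lerD; [exact: lp|rewrite (distrC x); exact: lB].
  by rewrite ler_wpM2r // /L'; case: (i); lra.
have leC i x : a <= x <= b -> [/\ Q i x / 2 <= B i x, Q i x / 2 <= (p i).2 x - B i x &
      B i x + ((p i).2 x - B i x) <= F i x].
  move=> xab; have [_ _ /(_ _ xab) [/andP[? ?] _]] := hp i.
  by have [? ? ?] := sle i x xab; split; lra.
exists (Stage n.+1 L'0 lB' lC leC) => /=; split => // i x xab.
by have [_ _ /(_ _ xab) [/andP[? ?] ?]] := hp i; split; lra.
Qed.

(** Even-indexed minorants increase to [w], and [z = F - w] lies above the odd-indexed ones. Step
    [n] squeezes one summand between [B n.+1], which is [L n]-Lipschitz, and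
    [B n.+1 + rad (L n) n]. *)
Lemma alternating_decomposition a b F Q LQ : a <= b ->
  (forall i, cont_on a b (F i)) -> 0 <= LQ -> (forall i, lip LQ (Q i)) ->
  (forall i x, a <= x <= b -> Q i x <= F i x) ->
  exists w z, [/\ forall i x, a <= x <= b ->
      [/\ w i x + z i x = F i x, Q i x / 2 <= w i x & Q i x / 2 <= z i x],
    good_on (seg a b) xpred0 w & good_on (seg a b) xpred0 z].
Proof.
move=> ab cF LQ0 lQ QF.
have lQ2 i : lip LQ (fun x => Q i x / 2).
  move=> x y; rewrite -mulrBl normrM [`|2^-1|]gtr0_norm ?invr_gt0 //.
  have := lQ i x y; have := normr_ge0 (Q i x - Q i y); lra.
have le0 i x : a <= x <= b -> [/\ Q i x / 2 <= Q i x / 2, Q i x / 2 <= Q i x / 2 &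
    Q i x / 2 + Q i x / 2 <= F i x].
  by move=> xab; split => //; have := QF i x xab; lra.
pose s0 : stage a b F Q := Stage 0 LQ0 lQ2 lQ2 le0.
have [s [s00 hs]] := dependent_choice (fun s => @stage_next a b F Q s ab cF) s0.
have sn n : stage_n (s n) = n.
  by elim: n => [|n IH]; [rewrite s00|have [-> _ _] := hs n; rewrite IH].
(* Since each stage inherits its [A] from the previous [B], all minorants form one sequence. *)
pose B n := stage_A (s n).
have BS n : stage_B (s n) = B n.+1 by have [_ <- _] := hs n.
pose L n := stage_L (s n).
have L0 n : 0 <= L n by exact: stage_L0.
have lB n i : lip (L n) (B n.+1 i) by rewrite -BS; exact: stage_lB.
have step n i x : a <= x <= b -> [/\ Q i x / 2 <= B n i x, B n i x <= B n.+2 i x,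
    B n i x + B n.+1 i x <= F i x &
    F i x <= B n.+1 i x + B n.+2 i x + rad (L n) n].
  move=> xab; have [] := stage_le (s n) i xab; rewrite BS -/(B n) => h1 _ h2.
  have [_ _ /(_ i x xab)] := hs n; rewrite !BS sn -/(B n) -/(L n) => -[h3 h4].
  by split.
have mono n k i x : a <= x <= b -> B n i x <= B (n + k.*2)%N i x.
  move=> xab; elim: k => [|k IH]; first by rewrite addn0.
  by apply: le_trans IH _; rewrite doubleS !addnS; have [] := step (n + k.*2)%N i x xab.
(* Both indices are raised, within their parity, to two adjacent ones. *)
have eo m n i x : a <= x <= b -> B m.*2 i x + B n.*2.+1 i x <= F i x.
  move=> xab; have := mono m.*2 n i x xab; have := mono n.*2.+1 m i x xab.
  rewrite addSn [(n.*2 + m.*2)%N]addnC.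
  by have [_ _ ? _] := step (m.*2 + n.*2)%N i x xab; lra.
pose w i x := sup [set B n.*2 i x | n in [set: nat]].
have wlo n i x : a <= x <= b -> B n.*2 i x <= w i x.
  move=> xab; apply: ub_le_sup; last by exists n.
  by exists (F i x - B 1 i x) => _ [m _ <-]; have := eo m 0 i x xab; rewrite /=; lra.
have whi n i x : a <= x <= b -> w i x <= F i x - B n.*2.+1 i x.
  move=> xab; apply: ge_sup; first by exists (B 0 i x), 0%N.
  by move=> _ [m _ <-]; have := eo m n i x xab; lra.
exists w, (fun i x => F i x - w i x); split.
- move=> i x xab; split; first by rewrite addrC subrK.
    by apply: le_trans (wlo 0%N i x xab); have [] := step 0%N i x xab.
  have := whi 0%N i x xab; have [] := step 1%N i x xab; rewrite /=; lra.
- move=> n; exists (L n.*2.+1), (B n.*2.+2); split => // i _; split => x.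
    by move=> y _ _; exact: lB.
  move=> xab; have := wlo n.+1 i x xab; have := whi n.+1 i x xab; rewrite doubleS.
  have [_ _ _ h] := step n.*2.+1 i x xab.
  have : rad (L n.*2.+1) n.*2.+1 <= rad (L n.*2.+1) n.
    apply: le_rad; rewrite // ?lerD2l ?ler_nat; lia.
  by move=> ? ? ?; rewrite ger0_norm; lra.
- move=> n; exists (L n.*2), (B n.*2.+1); split => // i _; split => x.
    by move=> y _ _; exact: lB.
  move=> xab; have := wlo n.+1 i x xab; have := whi n i x xab; rewrite doubleS.
  have [_ _ _ h] := step n.*2 i x xab.
  have : rad (L n.*2) n.*2 <= rad (L n.*2) n.
    apply: le_rad; rewrite // ?lerD2l ?ler_nat; lia.
  by move=> ? ? ?; rewrite ger0_norm; lra.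
Qed.

(** Since [rad L n] is at most [1 / (n + 1)], [w i] is a uniform limit of Lipschitz functions. *)
Lemma good_on_cont a b w i : good_on (seg a b) xpred0 w -> cont_on a b (w i).
Proof.
move=> gw x xab e e0.
pose n := Num.truncn (4 / e).
have n4 : 4 / e < n.+1%:R.
  exact: truncnS_gt.
have [L [G [L0 /(_ i isT)[lG wG]]]] := gw n.
have rn : rad L n <= e / 4.
  apply: (@le_trans _ _ n.+1%:R^-1).
    rewrite /rad; apply: (@le_trans _ _ ((L + n%:R + 2)^-1 ^+ 1)).
      apply: ler_wiXn2l => //; rewrite ?invr_ge0 ?addr_ge0 //.
      by rewrite invf_le1; have := ler0n R n; lra.
    rewrite expr1 -natr1 lef_pV2 ?posrE; have := ler0n R n; lra.
  by rewrite -[leRHS]invrK invf_div lef_pV2 ?posrE ?divr_gt0 // ltW.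
exists (e / (4 * (L + 1))); first by rewrite divr_gt0 // mulr_gt0 // ltr_wpDl.
move=> y yab xy.
have h1 := wG x xab; have h2 := wG y yab; have h3 := lG x y xab yab.
have h4 : L * `|x - y| <= e / 4.
  apply: (@le_trans _ _ ((L + 1) * `|x - y|)); first by rewrite ler_wpM2r //; lra.
  have L1 : 0 < L + 1 by rewrite ltr_wpDl.
  rewrite -ler_pdivlMl //; apply: le_trans (ltW xy) _.
  by rewrite invfM mulrA mulrC.
rewrite distrC in h2.
have : `|w i x - w i y| <= `|w i x - G i x| + `|G i x - G i y| + `|G i y - w i y|.
  by apply: le_trans (ler_distD (G i y) _ _) _; rewrite lerD2r ler_distD.
lra.
Qed.

End AlternatingDecomposition.

(** * Locally Lipschitz extension from a closed set *)

Section LocallyLipschitzExtension.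
Variable R : realType.
Implicit Types (a b x y z e : R) (D : set R) (F : R -> R).

Lemma closed_far D x : closed D -> ~ D x ->
  exists2 d : R, 0 < d & forall y, D y -> d <= `|x - y|.
Proof.
move=> cD nDx.
have := closed_openC cD; rewrite openE => /(_ x nDx)/nbhs_ballP[d /= d0 hd].
by exists d => // y Dy; rewrite leNgt; apply/negP => xy; exact: hd Dy.
Qed.

(** For closed [D] these sets exhaust the rest of the interval; the extension is Lipschitz on
    each. *)
Definition far D a b (m : nat) : set R :=
  [set x | a <= x <= b /\ forall y, D y -> m.+1%:R^-1 <= `|x - y|].

Lemma far_cover D a b x : closed D -> a <= x <= b -> ~ D x ->
  exists m, far D a b m x.
Proof.
move=> cD xab /(closed_far cD)[d d0 hd].
exists (Num.truncn d^-1); split => // y /hd; apply: le_trans.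
rewrite -[leRHS]invrK lef_pV2 ?posrE ?invr_gt0 //.
exact/ltW/truncnS_gt.
Qed.

Definition cont_in D F := forall x, D x -> forall e, 0 < e ->
  exists2 d : R, 0 < d & forall y, D y -> `|x - y| < d -> `|F x - F y| < e.

(* Hausdorff's formula: off [D] the extension is the infimum over [y] in [D] of
   [F y + |x - y| / dist x - 1], where [dist] is the distance to [D]. *)
Lemma locally_lipschitz_extension D a b F M : D !=set0 -> closed D ->
  D `<=` seg a b -> (forall x, D x -> `|F x| <= M) -> cont_in D F ->
  exists psi : R -> R, [/\ forall x, D x -> psi x = F x,
    forall x, `|psi x| <= M, cont_on a b psi &
    forall m, exists2 L, 0 <= L & forall x y, far D a b m x -> far D a b m y ->
      `|psi x - psi y| <= L * `|x - y|].
Proof.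
move=> [z0 Dz0] cD Dab FM cF.
have M0 : 0 <= M by apply: le_trans (FM _ Dz0).
pose dist x := inf [set `|x - y| | y in D].
have dist_le x y : D y -> dist x <= `|x - y| by exact: norm_inf_le.
have le_dist x d : (forall y, D y -> d <= `|x - y|) -> d <= dist x.
  by apply: le_norm_inf; exists z0.
have dist_gt0 x : ~ D x -> 0 < dist x.
  by move=> /(closed_far cD)[d d0 hd]; apply: lt_le_trans d0 (le_dist _ _ hd).
have dist_lip x y : dist x <= dist y + `|x - y|.
  rewrite -lerBlDr; apply: le_dist => z Dz; rewrite lerBlDr.
  by have := dist_le x z Dz; have := ler_distD y x z; lra.
have dist_near x e : 0 < e -> exists2 y, D y & `|x - y| < dist x + e.
  move=> e0; have [|_ [y Dy <-] ?] := @inf_adherent _ [set `|x - y| | y in D] e e0.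
    split; first by exists `|x - z0|, z0.
    by exists 0 => _ [y _ <-].
  by exists y.
pose T x y := F y + `|x - y| / dist x - 1.
pose S x := [set T x y | y in D].
have Tlb x y : ~ D x -> D y -> F y <= T x y.
  move=> /dist_gt0 d0 Dy; rewrite /T -addrA lerDl subr_ge0.
  by rewrite ler_pdivlMr // mul1r dist_le.
have Slb x : ~ D x -> has_lbound (S x).
  move=> nDx; exists (- M) => _ [y Dy <-]; apply: le_trans (Tlb x y nDx Dy).
  by have := FM y Dy; rewrite ler_norml => /andP[].
have S0 x : S x !=set0 by exists (T x z0), z0.
pose psi x := if pselect (D x) then F x else inf (S x).
have psiD x : D x -> psi x = F x by rewrite /psi; case: pselect.
have psiN x : ~ D x -> psi x = inf (S x) by rewrite /psi; case: pselect.
have psi_ge x c : ~ D x -> (forall y, D y -> c <= T x y) -> c <= psi x.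
  by move=> nDx h; rewrite psiN //; apply: lb_le_inf => // _ [y Dy <-]; exact: h.
have psi_le x y : ~ D x -> D y -> psi x <= T x y.
  by move=> nDx Dy; rewrite psiN //; apply: ge_inf; [exact: Slb|exists y].
(* Near-minimisers of the distance have quotient close to 1, so values of [F] within twice the
   distance control [psi] from above. *)
have psi_up x c : ~ D x -> (forall y, D y -> `|x - y| < 2 * dist x -> F y <= c) ->
    psi x <= c.
  move=> nDx h; apply/ler_addgt0Pr => e e0.
  have d0 := dist_gt0 x nDx.
  have [|y Dy xy] := dist_near x (Num.min e 1 * dist x).
    by rewrite mulr_gt0 // lt_min e0 ltr01.
  have m1 : Num.min e 1 <= 1 by rewrite ge_min lexx orbT.
  have me : Num.min e 1 <= e by rewrite ge_min lexx.
  apply: le_trans (psi_le x y nDx Dy) _.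
  have : `|x - y| / dist x <= 1 + Num.min e 1.
    by rewrite ler_pdivrMr // mulrDl mul1r ltW.
  have : F y <= c.
    apply: h => //; apply: lt_le_trans xy _.
    by rewrite mulrDl mul1r lerD2l -[leRHS]mul1r ler_wpM2r // ltW.
  by rewrite /T; lra.
have psiM x : `|psi x| <= M.
  have [Dx|nDx] := pselect (D x); first by rewrite psiD // FM.
  rewrite ler_norml; apply/andP; split.
    apply: psi_ge => // y Dy; apply: le_trans (Tlb x y nDx Dy).
    by have := FM y Dy; rewrite ler_norml => /andP[].
  by apply: psi_up => // y Dy _; have := FM y Dy; rewrite ler_norml => /andP[].
have psi_lip m : exists2 L, 0 <= L & forall x y, far D a b m x -> far D a b m y ->
    `|psi x - psi y| <= L * `|x - y|.
  pose d : R := m.+1%:R^-1.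
  have d0 : 0 < d by rewrite invr_gt0.
  have ba : 0 <= b - a by have := Dab _ Dz0; rewrite /seg /= => /andP[]; lra.
  (* The first term pays for the change of the numerator [|x - z|], the second for that of the
     denominator [dist x]. *)
  pose L := d^-1 + (b - a) / d ^+ 2.
  have L0 : 0 <= L.
    by rewrite addr_ge0 ?invr_ge0 ?mulr_ge0 ?invr_ge0 ?exprn_ge0 // ltW.
  exists L => //.
  suff one x y : far D a b m x -> far D a b m y -> psi x - L * `|x - y| <= psi y.
    move=> x y fx fy; have := one x y fx fy; have := one y x fy fx.
    by rewrite (distrC y) ler_norml; lra.
  move=> [xab fx] [yab fy].
  have nD z : (forall y, D y -> d <= `|z - y|) -> ~ D z.
    by move=> h Dz; have := h z Dz; rewrite subrr normr0 leNgt d0.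
  have dx : d <= dist x by exact: le_dist.
  have dy : d <= dist y by exact: le_dist.
  have dx0 : 0 < dist x by exact: lt_le_trans dx.
  have dy0 : 0 < dist y by exact: lt_le_trans dy.
  apply: psi_ge; first exact: nD.
  move=> z Dz; rewrite lerBlDr; apply: le_trans (psi_le x z (nD _ fx) Dz) _.
  suff : `|x - z| / dist x <= `|y - z| / dist y + L * `|x - y| by rewrite /T; lra.
  have h1 : `|x - z| / dist x <= `|y - z| / dist x + `|x - y| / d.
    apply: (@le_trans _ _ ((`|x - y| + `|y - z|) / dist x)).
      by rewrite ler_wpM2r ?invr_ge0 ?ler_distD // ltW.
    rewrite mulrDl addrC lerD2l ler_wpM2l // lef_pV2 ?posrE //.
  have h2 : `|y - z| / dist x <= `|y - z| / dist y + (b - a) / d ^+ 2 * `|x - y|.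
    have -> : `|y - z| / dist x = `|y - z| / dist y +
        `|y - z| * ((dist y - dist x) * ((dist x)^-1 * (dist y)^-1)).
      by field; rewrite !gt_eqF.
    have p0 : 0 <= (dist x)^-1 * (dist y)^-1 by rewrite mulr_ge0 // invr_ge0 ltW.
    have p1 : (dist x)^-1 * (dist y)^-1 <= (d ^+ 2)^-1.
      by rewrite expr2 invfM ler_pM ?invr_ge0 ?(ltW dx0) ?(ltW dy0) // lef_pV2 ?posrE.
    have zb : `|y - z| <= b - a.
      by have := Dab _ Dz; rewrite ler_norml /seg /= => /andP[? ?]; lra.
    have dd : dist y - dist x <= `|x - y|.
      by have := dist_lip y x; rewrite distrC; lra.
    rewrite lerD2l -mulrA; apply: (@le_trans _ _ ((b - a) *
        (`|x - y| * ((dist x)^-1 * (dist y)^-1)))).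
      apply: (@le_trans _ _ (`|y - z| * (`|x - y| * ((dist x)^-1 * (dist y)^-1)))).
        by rewrite ler_wpM2l // ler_wpM2r.
      by rewrite ler_wpM2r // mulr_ge0.
    by rewrite ler_wpM2l // mulrC ler_wpM2r.
  by rewrite /L mulrDl (mulrC d^-1); lra.
exists psi; split => // x xab e e0.
have [Dx|nDx] := pselect (D x); last first.
  have [m [_ fm]] := far_cover cD xab nDx.
  (* Points within [d / 2] of [x] are still at distance [d / 2] from [D], and this index asks for
     slightly less. *)
  have [L L0 hL] := psi_lip (m.+1 * 2)%N.
  pose d : R := m.+1%:R^-1; have d0 : 0 < d by rewrite invr_gt0.
  have L1 : 0 < L + 1 by rewrite ltr_wpDl.
  exists (Num.min (d / 2) (e / (L + 1))); first by rewrite lt_min !divr_gt0.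
  move=> y yab; rewrite lt_min => /andP[xy1 xy2].
  have d2 : (m.+1 * 2).+1%:R^-1 <= d / 2.
    by rewrite -invfM -natrM lef_pV2 ?posrE ?ltr0n // ler_nat.
  apply: le_lt_trans (hL x y _ _) _.
  - by split => // z /fm; apply: le_trans; apply: le_trans d2 _; rewrite -/d; lra.
  - split => // z /fm h; apply: le_trans d2 _.
    by have := ler_distD y x z; rewrite -/d in h; lra.
  apply: (@le_lt_trans _ _ ((L + 1) * `|x - y|)); first by rewrite ler_wpM2r //; lra.
  by rewrite mulrC -ltr_pdivlMr.
have e2 : 0 < e / 2 by rewrite divr_gt0.
have [d d0 hd] := cF x Dx _ e2.
(* The bound [d / 3] keeps points within [2 * dist y] of [y] inside the [d]-ball of [x]; the other
   bound makes the quotient at least [2 * M + 1] outside that ball, where [T] then exceeds every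
   value of [F]. *)
pose r := Num.min (d / 3) (d / (2 * M + 4)).
have M4 : 0 < 2 * M + 4 by rewrite ltr_wpDl // mulr_ge0.
have r0 : 0 < r by rewrite lt_min !divr_gt0.
exists r => // y yab xy.
have [Dy|nDy] := pselect (D y).
  rewrite !psiD //; apply: lt_trans (hd y Dy _) _; last by lra.
  by move: xy; rewrite lt_min; lra.
rewrite psiD //.
have rd : r <= d / 3 by rewrite ge_min lexx.
have rM : r * (2 * M + 4) <= d by rewrite -ler_pdivlMr // ge_min lexx orbT.
have dy := dist_gt0 y nDy.
have dyx : dist y <= `|x - y| by rewrite distrC dist_le.
have up : psi y <= F x + e / 2.
  apply: psi_up => // z Dz yz.
  have : `|F x - F z| < e / 2.
    by apply: hd => //; have := ler_distD y x z; lra.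
  by rewrite ltr_norml; lra.
have lo : F x - e / 2 <= psi y.
  apply: psi_ge => // z Dz.
  have [xz|xz] := ltP `|x - z| d.
    apply: le_trans (Tlb y z nDy Dz).
    by have := hd z Dz xz; rewrite ltr_norml; lra.
  have h : 2 * M + 1 <= `|y - z| / dist y.
    rewrite ler_pdivlMr //.
    apply: (@le_trans _ _ ((2 * M + 1) * r)).
      by rewrite ler_wpM2l //; lra.
    by have := ler_distD y x z; lra.
  have := FM x Dx; have := FM z Dz; rewrite !ler_norml /T => /andP[? ?] /andP[? ?].
  lra.
apply: (@le_lt_trans _ _ (e / 2)); last by lra.
by rewrite ler_norml; lra.
Qed.

End LocallyLipschitzExtension.

(** * Cantor sets and reals coded by binary digits *)

Section BinaryCoding.
Variable R : realType.
Implicit Types (e d : nat -> bool) (len : nat -> R) (x y : R).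

Definition agree n e e' := forall i, (i < n)%N -> e i = e' i.

(** An interval of length [len n] has two children of length [len n.+1] at its two ends; each digit
    selects a child, and this sum is the offset of the left endpoint. For [len = dy] it is the usual
    binary sum. *)
Definition psum len e n : R := \sum_(i < n) (e i)%:R * (len i - len i.+1).
Definition bval len e : R := sup [set psum len e n | n in [set: nat]].

Lemma psumS len e n :
  psum len e n.+1 = psum len e n + (e n)%:R * (len n - len n.+1).
Proof. by rewrite /psum big_ord_recr. Qed.

Lemma psum_agree len n e e' : agree n e e' -> psum len e n = psum len e' n.
Proof. by move=> h; apply: eq_bigr => i _; rewrite h. Qed.

Section Len.
Variable len : nat -> R.
Hypothesis len_ge0 : forall n, 0 <= len n.
Hypothesis len_le : forall n, len n.+1 <= len n.

Lemma digit_bounds e n : 0 <= (e n)%:R * (len n - len n.+1) <= len n - len n.+1.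
Proof. by have := len_le n; case: (e n); rewrite ?mul1r ?mul0r => ?; lra. Qed.

Lemma psum_mono e n k : psum len e n <= psum len e (n + k) <=
  psum len e n + len n - len (n + k)%N.
Proof.
elim: k => [|k /andP[IH1 IH2]]; first by rewrite addn0; lra.
by rewrite addnS psumS; have /andP[] := digit_bounds e (n + k)%N; lra.
Qed.

Lemma psum_le_tail e m n : psum len e m <= psum len e n + len n.
Proof.
have [mn|/ltnW nm] := leqP m n.
  have /andP[+ _] := psum_mono e m (n - m); rewrite subnKC //.
  by have := len_ge0 n; lra.
have /andP[_] := psum_mono e n (m - n); rewrite subnKC //.
by have := len_ge0 m; lra.
Qed.

Lemma bval_bounds e n : psum len e n <= bval len e <= psum len e n + len n.
Proof.
apply/andP; split.
  apply: ub_le_sup; last by exists n.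
  by exists (psum len e 0 + len 0%N) => _ [m _ <-]; exact: psum_le_tail.
apply: ge_sup; first by exists (psum len e 0), 0%N.
by move=> _ [m _ <-]; exact: psum_le_tail.
Qed.

Lemma bval_agree n e e' : agree n e e' -> `|bval len e - bval len e'| <= len n.
Proof.
move=> /(psum_agree len) h; have := bval_bounds e n; have := bval_bounds e' n.
by rewrite h ler_norml => /andP[? ?] /andP[? ?]; lra.
Qed.

Definition cyl x0 n e x := x0 + psum len e n <= x <= x0 + psum len e n + len n.

Lemma cyl_agree x0 n e e' x : agree n e e' -> cyl x0 n e x -> cyl x0 n e' x.
Proof. by rewrite /cyl => /(psum_agree len)->. Qed.

Lemma cylS x0 n e x : cyl x0 n.+1 e x -> cyl x0 n e x.
Proof.
rewrite /cyl psumS => /andP[? ?].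
by have /andP[? ?] := digit_bounds e n; lra.
Qed.

Lemma cyl_le x0 m n e x : (m <= n)%N -> cyl x0 n e x -> cyl x0 m e x.
Proof.
move=> mn; rewrite -(subnKC mn); elim: (n - m)%N => [|k IH]; first by rewrite addn0.
by rewrite addnS => /cylS.
Qed.

(** At the first differing digit [i] the points fall into different children, separated by the gap
    [len i - 2 * len i.+1]. *)
Lemma cyl_separated x0 n e e' x x' : cyl x0 n e x -> cyl x0 n e' x' ->
  agree n e e' \/ exists i, [/\ (i < n)%N, agree i e e' &
    len i - 2 * len i.+1 <= `|x - x'|].
Proof.
elim: n => [|n IH] c c'; first by left.
have [h|[i [? ? ?]]] := IH (cylS c) (cylS c'); last first.
  by right; exists i; split => //; apply: ltnW.
have [en|en] := eqVneq (e n) (e' n).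
  left => i; rewrite ltnS leq_eqVlt => /orP[/eqP->//|]; exact: h.
right; exists n; split => //.
move: c c'; rewrite /cyl !psumS (psum_agree len h) => /andP[h1 h2] /andP[h3 h4].
move: en h1 h2 h3 h4; case: (e n); case: (e' n) => // _;
  rewrite ?mul1r ?mul0r ?addr0 => h1 h2 h3 h4.
  by apply: le_trans (ler_norm _); lra.
by rewrite distrC; apply: le_trans (ler_norm _); lra.
Qed.

(** The code may vary with the level, which exhibits the set as an intersection of finite unions of
    intervals; positive gaps give a single code in [cantor_code]. *)
Definition cantor x0 : set R := [set x | forall n, exists e, cyl x0 n e x].

Lemma cyl_bval x0 n e : cyl x0 n e (x0 + bval len e).
Proof. by have := bval_bounds e n; rewrite /cyl => /andP[? ?]; lra. Qed.

Lemma cantor_bval x0 e : cantor x0 (x0 + bval len e).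
Proof. by move=> n; exists e; exact: cyl_bval. Qed.

Lemma cyl_tuple x0 n e x : cyl x0 n e x ->
  exists t : n.-tuple bool, cyl x0 n (nth false t) x.
Proof.
move=> c; exists [tuple of mkseq e n]; apply: cyl_agree c => i ni.
by rewrite nth_mkseq.
Qed.

Lemma closed_cantor x0 : closed (cantor x0).
Proof.
have -> : cantor x0 = \bigcap_(n in [set: nat])
    \bigcup_(t in [set: n.-tuple bool])
      seg (x0 + psum len (nth false t) n) (x0 + psum len (nth false t) n + len n).
  apply/seteqP; split => x h n.
    by move=> _; have [e /cyl_tuple[t ct]] := h n; exists t.
  by have [t _ ct] := h n I; exists (nth false t).
apply: closed_bigI => n _; apply: closed_bigcup; first exact: finite_finset.
move=> t _; apply: compact_closed; first exact: norm_hausdorff.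
by have [|_ [? _]] := @seg_Kc R (x0 + psum len (nth false t) n)
  (x0 + psum len (nth false t) n + len n); first by have := len_ge0 n; lra.
Qed.

Hypothesis gap_gt0 : forall n, 0 < len n - 2 * len n.+1.

Lemma cantor_code x0 x : cantor x0 x -> exists e, forall n, cyl x0 n e x.
Proof.
move=> /choice[f hf].
have ag m n : (m <= n)%N -> agree m (f m) (f n).
  move=> mn; have [//|[i [_ _]]] := cyl_separated (hf m) (cyl_le mn (hf n)).
  by rewrite subrr normr0 leNgt gap_gt0.
(* Digit [i] is read off at the first level that determines it. *)
exists (fun i => f i.+1 i) => n; apply: cyl_agree (hf n) => i ni.
by rewrite (ag _ _ ni).
Qed.

Lemma cantor_near n : exists2 d : R, 0 < d & forall x0 e e' x x', cyl x0 n e x ->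
  cyl x0 n e' x' -> `|x - x'| < d -> agree n e e'.
Proof.
have [d d0 hd] : exists2 d : R, 0 < d &
    forall i, (i < n)%N -> d <= len i - 2 * len i.+1.
  elim: n => [|n [d d0 hd]]; first by exists 1.
  exists (Num.min d (len n - 2 * len n.+1)); first by rewrite lt_min d0 gap_gt0.
  move=> i; rewrite ltnS leq_eqVlt => /orP[/eqP->|/hd h].
    by rewrite ge_min lexx orbT.
  by rewrite ge_min h.
exists d => // x0 e e' x x' c c' xx.
have [//|[i [/hd h _ h']]] := cyl_separated c c'.
by have := lt_le_trans xx (le_trans h h'); rewrite ltxx.
Qed.

End Len.

Definition dy (n : nat) : R := 2^-1 ^+ n.

Lemma dy_ge0 n : 0 <= dy n. Proof. by rewrite exprn_ge0 // invr_ge0. Qed.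

Lemma dyS n : dy n.+1 = dy n / 2.
Proof. by rewrite /dy exprSr. Qed.

Lemma dy_le n : dy n.+1 <= dy n.
Proof. by rewrite dyS; have := dy_ge0 n; lra. Qed.

Lemma dy_small (e : R) : 0 < e -> exists n, dy n < e.
Proof.
move=> e0; exists (Num.truncn e^-1).
have h : e^-1 < (2 ^ Num.truncn e^-1)%:R.
  apply: lt_le_trans (truncnS_gt _) _; rewrite ler_nat; exact: ltn_expl.
by rewrite /dy exprVn -natrX -[ltRHS]invrK ltf_pV2 ?posrE ?invr_gt0 // ltr0n expn_gt0.
Qed.

Lemma bval_dy01 e : 0 <= bval dy e <= 1.
Proof.
have := bval_bounds dy_ge0 dy_le e 0%N.
by rewrite /psum big_ord0 add0r /dy expr0.
Qed.

(** Greedy expansion: the remainder after [n] digits stays between 0 and [dy n]. The non-strict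
    comparison gives [y = 1] the digits 1, 1, 1 and so on. *)
Lemma binary_expansion y : 0 <= y <= 1 -> exists d : nat -> bool, bval dy d = y.
Proof.
move=> y01.
pose rem := fix rem n := if n is m.+1 then
  (if dy m.+1 <= rem m then rem m - dy m.+1 else rem m) else y.
pose d n := dy n.+1 <= rem n.
have remS n : rem n.+1 = rem n - (d n)%:R * dy n.+1.
  by rewrite /= /d; case: ifP; rewrite ?mul1r ?mul0r ?subr0.
have rem_b n : 0 <= rem n <= dy n.
  elim: n => [|n /andP[IH1 IH2]]; first by rewrite /dy expr0.
  by rewrite remS /d; have := dyS n; case: (leP (dy n.+1) (rem n)); rewrite ?mul1r ?mul0r => ? ?; lra.
have hp n : psum dy d n = y - rem n.
  elim: n => [|n IH]; first by rewrite /psum big_ord0 /= subrr.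
  rewrite psumS IH remS (dyS n); case: (d n); rewrite ?mul1r ?mul0r; lra.
exists d; apply/eqP; rewrite -subr_eq0 -normr_eq0 eq_le normr_ge0 andbT.
apply/ler_addgt0Pr => e e0; rewrite add0r.
have [n ne] := dy_small e0.
have := bval_bounds dy_ge0 dy_le d n; have := rem_b n; rewrite hp ler_norml.
by move=> /andP[? ?] /andP[? ?]; lra.
Qed.

End BinaryCoding.

(** * Interleaving digit sequences *)

Section Layout.

(** The ceiling of the square root of [i], equally the number of squares below [i]; thus [i - sqc i]
    counts the non-squares below [i]. *)
Fixpoint sqc (i : nat) : nat :=
  if i is j.+1 then (if j == sqc j ^ 2 then (sqc j).+1 else sqc j)%N else 0%N.

Definition is_sq (i : nat) := (i == sqc i ^ 2)%N.

Lemma sqcS i : sqc i.+1 = (if is_sq i then (sqc i).+1 else sqc i).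
Proof. by []. Qed.

Lemma sqc_bounds i : (i <= sqc i ^ 2 /\ ((sqc i).-1 ^ 2 < i \/ sqc i = 0) /\ sqc i <= i)%N.
Proof.
elim: i => [|i]; first by split=> //; split=> //; right.
rewrite sqcS /is_sq; case: eqP; move: (sqc i) => c; nia.
Qed.

Lemma sqc_sq j : sqc (j ^ 2)%N = j.
Proof. have := sqc_bounds (j ^ 2)%N; move: (sqc _) => c; nia. Qed.

Lemma is_sq_sq j : is_sq (j ^ 2)%N.
Proof. by rewrite /is_sq sqc_sq. Qed.

(* Square positions carry the side bit (at 0) and the digits of the two
   values [y1], [y2] (odd and even roots); the other positions, which have
   full density, carry the digits of the free parameter. *)
Definition encode (b : bool) (d0 d1 d2 : nat -> bool) (i : nat) : bool :=
  if is_sq i then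
    (if sqc i is c.+1 then (if odd c then d2 c./2 else d1 c./2) else b)
  else d0 (i - sqc i)%N.

Definition value_digits (h : bool) (e : nat -> bool) (m : nat) : bool :=
  e ((m.*2.+1 + h) ^ 2)%N.

Lemma encode0 b d0 d1 d2 : encode b d0 d1 d2 0 = b.
Proof. by []. Qed.

Lemma value_digits_encode h b d0 d1 d2 :
  value_digits h (encode b d0 d1 d2) =1 if h then d2 else d1.
Proof.
move=> m; rewrite /value_digits /encode is_sq_sq sqc_sq addSn.
by case: h; rewrite ?addn1 ?addn0 /= odd_double /= ?doubleK //= uphalf_double.
Qed.

(** The first [i] positions contain exactly [i - sqc i] non-squares, which hold the initial digits
    of the free parameter. *)
Lemma encode_agree i b d0 d1 d2 b' d0' d1' d2' :
  agree i (encode b d0 d1 d2) (encode b' d0' d1' d2') -> agree (i - sqc i) d0 d0'.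
Proof.
elim: i => [|i IH] // h m mi.
have /IH h' : agree i (encode b d0 d1 d2) (encode b' d0' d1' d2').
  by move=> k ki; apply: h; apply: ltnW.
have := sqc_bounds i; move: mi; rewrite sqcS; case: ifP => si mi [_ [_ ci]].
  by apply: h'; move: mi; rewrite subSS.
move: mi; rewrite subSn // ltnS leq_eqVlt => /orP[/eqP->|]; last exact: h'.
by have := h i (ltnSn i); rewrite /encode si.
Qed.

End Layout.

(** * A Cantor set of dimension [s] carrying independent values *)

Section CantorSet.
Variable R : realType.
Implicit Types (x y s r kappa : R).

(** With [c = sqc i] about the square root of [i], the left side is at most [16 * 8 ^ c], which is
    subexponential in [i]. *)
Lemma pow8_bound (rho : R) : 1 < rho -> exists2 K : R, 0 < K &
  forall i, 2 ^+ sqc i * (i.+2%:R) ^+ 2 <= K * rho ^+ i.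
Proof.
move=> rho1.
have [N hN] : exists N : nat, 8 <= rho ^+ N.
  pose N := Num.truncn (8 / (rho - 1)).
  exists N.+1; have r1 : 0 < rho - 1 by rewrite subr_gt0.
  have h : 8 / (rho - 1) < N.+1%:R by exact: truncnS_gt.
  rewrite ltr_pdivrMr // in h.
  have bern n : 1 + n%:R * (rho - 1) <= rho ^+ n.
    elim: n => [|n IH]; first by rewrite mul0r addr0 expr0.
    rewrite exprS -natr1.
    apply: (@le_trans _ _ (rho * (1 + n%:R * (rho - 1)))).
      have : 0 <= n%:R * ((rho - 1) * (rho - 1)) :> R by rewrite !mulr_ge0 // ltW.
      by lra.
    by rewrite ler_wpM2l // ltW // (lt_trans ltr01).
  by have := bern N.+1; lra.
exists (128 * rho ^+ (N ^ 2)); first by rewrite mulr_gt0 // exprn_gt0 // (lt_trans ltr01).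
move=> i; have [b1 [b2 _]] := sqc_bounds i; move: (sqc i) b1 b2 => c b1 b2.
have c2 : (c ^ 2 + 2 <= 4 * 2 ^ c)%N.
  elim: c {b1 b2} => // c; have := @ltn_expl 2 c isT; rewrite [(2 ^ c.+1)%N]expnS -!mulnn.
  by move: (2 ^ c)%N => t; nia.
have h1 : 2 ^+ c * (i.+2%:R) ^+ 2 <= 16 * 8 ^+ c :> R.
  rewrite -!natrX -!natrM ler_nat.
  apply: (@leq_trans (2 ^ c * (4 * 2 ^ c) ^ 2)).
    by rewrite leq_mul2l leq_exp2r // (leq_trans _ c2) ?orbT // addn2 !ltnS.
  by rewrite (_ : 8 = 2 ^ 3)%N // -expnM mulnC [(3 * c)%N]mulnC expnM; move: (2 ^ c)%N => t; nia.
apply: le_trans h1 _.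
apply: (@le_trans _ _ (128 * 8 ^+ c.-1)).
  by case: (c) => [|k]; rewrite ?exprS /= ?expr0; [lra|have := exprn_ge0 k (ler0n R 8); lra].
rewrite -mulrA ler_wpM2l //.
apply: (@le_trans _ _ ((rho ^+ N) ^+ c.-1)).
  by apply: lerXn2r => //; rewrite nnegrE // (le_trans _ hN).
(* By the arithmetic-geometric inequality, and since [c.-1 ^ 2 < i] unless [c = 0]. *)
have hc : (N * c.-1 <= N ^ 2 + i)%N.
  by case: b2 => [b2|->]; [have [+ _] := nat_Cauchy N c.-1; lia|rewrite muln0].
by rewrite -exprM -exprD ler_weXn2l ?(ltW rho1).
Qed.

Section Lengths.
Variables (s kappa : R).
Hypotheses (s01 : 0 < s <= 1) (kappa0 : 0 < kappa).

Let theta : R := powR 2 (- s^-1).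
(** As [powR theta s = 1 / 2], the [2 ^ n] intervals of length [theta ^ n] have constant [s]-sum.
    The divisor [n + 1] opens gaps even for [s = 1], where [theta = 1 / 2]. *)
Definition clen n : R := kappa * (theta ^+ n / n.+1%:R).

Let s0 : 0 < s. Proof. by case/andP: s01. Qed.
Let theta0 : 0 < theta. Proof. exact: powR_gt0. Qed.

Let thetas : powR theta s = 2^-1.
Proof. by rewrite /theta -powRrM mulNr mulVf ?gt_eqF // powR_inv1. Qed.

Let theta_half : theta <= 2^-1.
Proof.
rewrite -[leRHS]powR_inv1 // ler_powR //; first by lra.
by rewrite lerN2 -[leLHS]invr1 lef_pV2 ?posrE //; case/andP: s01.
Qed.

Lemma clen_gt0 n : 0 < clen n.
Proof. by rewrite mulr_gt0 // divr_gt0 // exprn_gt0. Qed.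

Lemma clen_ge0 n : 0 <= clen n. Proof. exact/ltW/clen_gt0. Qed.

(** Because [2 * theta <= 1], the gap is at least [kappa * theta ^ n] times
    [1 / (n + 1) - 1 / (n + 2)]. *)
Lemma clen_gap n :
  kappa * theta ^+ n / n.+2%:R ^+ 2 <= clen n - 2 * clen n.+1.
Proof.
rewrite /clen [theta ^+ n.+1]exprSr.
have t0 : 0 < theta ^+ n by rewrite exprn_gt0.
have n1 : 0 < n.+1%:R :> R by [].
have n2 : 0 < n.+2%:R :> R by [].
have en : n.+2%:R = n.+1%:R + 1 :> R by rewrite natr1.
apply: (@le_trans _ _ (kappa * theta ^+ n * (n.+1%:R^-1 - n.+2%:R^-1))).
  apply: ler_wpM2l; first by rewrite mulr_ge0 // ltW.
  rewrite (_ : n.+1%:R^-1 - n.+2%:R^-1 = (n.+1%:R * n.+2%:R)^-1); last first.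
    by rewrite en; field; rewrite !gt_eqF // -?en.
  have n12 : n.+1%:R * n.+2%:R <= n.+2%:R ^+ 2 :> R.
    by rewrite expr2 ler_wpM2r // ler_nat.
  by rewrite lef_pV2 // posrE ?mulr_gt0 ?exprn_gt0.
have h : theta * 2 <= 1 by have := theta_half; lra.
have : 0 <= kappa * theta ^+ n * (n.+2%:R^-1 * (1 - theta * 2)).
  by rewrite !mulr_ge0 ?invr_ge0 ?subr_ge0 // ltW.
have E (k t u v q : R) : k * (t * u) - 2 * (k * (t * q * v)) - k * t * (u - v) =
  k * t * (v * (1 - q * 2)) by ring.
by rewrite -subr_ge0 -[in X in _ -> X]subr_ge0 E subr0.
Qed.

Lemma clen_gap_gt0 n : 0 < clen n - 2 * clen n.+1.
Proof.
apply: lt_le_trans (clen_gap n).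
by rewrite !mulr_gt0 ?invr_gt0 ?exprn_gt0.
Qed.

Lemma clen_le n : clen n.+1 <= clen n.
Proof. by have := clen_gap_gt0 n; have := clen_ge0 n.+1; lra. Qed.

(** The least [n] with [kappa * theta ^ n <= r] works: minimality gives the term [2 * powR kappa s],
    and the summand 1 covers [n = 0]. *)
Lemma clen_cover r : 0 < r <= 1 -> exists n,
  clen n <= r /\ (2 ^ n)%:R * powR r s <= 1 + 2 * powR kappa s.
Proof.
move=> /andP[r0 r1].
have ex : exists n, kappa * theta ^+ n <= r.
  have [n hn] := @dy_small R (r / kappa) (divr_gt0 r0 kappa0).
  exists n; rewrite mulrC -ler_pdivlMr //; apply: le_trans (ltW hn).
  by apply: lerXn2r; rewrite ?nnegrE ?invr_ge0 // ltW.
exists (ex_minn ex); case: ex_minnP => n hn hmin; split.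
  apply: le_trans hn; rewrite /clen ler_wpM2l ?(ltW kappa0) //.
  by rewrite ler_piMr ?exprn_ge0 ?(ltW theta0) // invf_le1 ?ler1n.
have k0 : 0 <= powR kappa s by exact: powR_ge0.
case: n hn hmin => [|n] hn hmin.
  rewrite expn0 mul1r; apply: (@le_trans _ _ 1); last by lra.
  have p1 : powR 1 s = 1 by rewrite powR1.
  by rewrite -[leRHS]p1 ge0_ler_powR ?nnegrE // ltW.
have hr : r <= kappa * theta ^+ n.
  by rewrite leNgt; apply/negP => /ltW /hmin; rewrite ltnn.
have : powR r s <= powR kappa s * (2^-1) ^+ n.
  apply: (@le_trans _ _ (powR (kappa * theta ^+ n) s)).
    apply: ge0_ler_powR; rewrite ?nnegrE ?(ltW s0) ?(ltW r0) //.
    by rewrite mulr_ge0 ?exprn_ge0 ?(ltW kappa0) ?(ltW theta0).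
  rewrite powRM ?exprn_ge0 ?(ltW kappa0) ?(ltW theta0) //.
  by rewrite -powR_mulrn ?(ltW theta0) // powRAC thetas powR_mulrn.
move=> h; apply: (@le_trans _ _ ((2 ^ n.+1)%:R * (powR kappa s * 2^-1 ^+ n))).
  by rewrite ler_wpM2l.
rewrite natrX exprS exprVn.
have t0 : 2 ^+ n != 0 :> R by rewrite expf_neq0.
have -> : 2 * 2 ^+ n * (powR kappa s * (2 ^+ n)^-1) = 2 * powR kappa s by field.
by lra.
Qed.

(* [eta < s] absorbs the square positions, whose number is negligible. *)
Lemma clen_hoelder eta : 0 < eta < s -> exists2 K : R, 0 < K &
  forall i r, clen i - 2 * clen i.+1 <= r -> dy R (i - sqc i) <= K * powR r eta.
Proof.
move=> /andP[eta0 etas].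
(* Then [powR theta eta = rho / 2], and comparing with [dy] leaves a factor [2 ^ sqc i] and the
   squared denominator of the gap to be absorbed by [rho ^ i]. *)
pose rho : R := powR 2 (1 - eta / s).
have rho1 : 1 < rho.
  have h : 0 < 1 - eta / s by rewrite subr_gt0 ltr_pdivrMr // mul1r.
  have p1 : powR 1 (1 - eta / s) = 1 by rewrite powR1.
  rewrite -[ltLHS]p1.
  by apply: gt0_ltr_powR; rewrite ?nnegrE //; lra.
have [K K0 hK] := pow8_bound rho1.
exists (K / powR kappa eta); first by rewrite divr_gt0 // powR_gt0.
move=> i r hr.
have gap_i := le_trans (clen_gap i) hr.
set g := kappa * theta ^+ i / i.+2%:R ^+ 2 in gap_i.
have n2 : 1 <= i.+2%:R ^+ 2 :> R by rewrite -natrX ler1n.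
have n2' : 0 < i.+2%:R ^+ 2 :> R by lra.
have g0 : 0 < g by rewrite !mulr_gt0 ?invr_gt0 ?exprn_gt0.
have k0 := powR_gt0 eta kappa0.
apply: (@le_trans _ _ (K / powR kappa eta * powR g eta)); last first.
  rewrite ler_wpM2l ?divr_ge0 ?(ltW K0) ?(ltW k0) //.
  by apply: ge0_ler_powR; rewrite ?nnegrE ?(ltW eta0) ?(ltW g0) // (le_trans (ltW g0)).
have -> : powR g eta = powR kappa eta * powR theta eta ^+ i / powR (i.+2%:R ^+ 2) eta.
  rewrite /g powRM ?mulr_ge0 ?invr_ge0 ?exprn_ge0 ?(ltW kappa0) ?(ltW theta0) //.
  rewrite powRM ?exprn_ge0 ?(ltW kappa0) ?(ltW theta0) //.
  rewrite -[theta ^+ i]powR_mulrn ?(ltW theta0) // powRAC powR_mulrn ?powR_ge0 //.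
  congr (_ * _); rewrite -[in LHS]powR_inv1 ?(ltW n2') // -powRrM mulN1r powRN.
  by [].
rewrite mulrA mulrA divfK ?gt_eqF //.
have -> : powR theta eta = rho / 2.
  rewrite /theta -powRrM /rho powRD ?pnatr_eq0 ?implybT // powRr1 //.
  by rewrite mulrAC mulfV // mul1r mulNr mulrC.
have e1 : eta <= 1 by move: s01; lra.
have p2 : powR (i.+2%:R ^+ 2) eta <= i.+2%:R ^+ 2.
  by rewrite -[leRHS]powRr1 ?(ltW n2') // ler_powR.
have p1 : 0 < powR (i.+2%:R ^+ 2 : R) eta by rewrite powR_gt0.
rewrite ler_pdivlMr // expr_div_n mulrA ler_pdivlMr ?exprn_gt0 //.
apply: le_trans (hK i).
have [_ [_ ci]] := sqc_bounds i.
have -> : dy R (i - sqc i) * powR (i.+2%:R ^+ 2) eta * 2 ^+ i =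
    2 ^+ sqc i * powR (i.+2%:R ^+ 2) eta.
  rewrite mulrAC; congr (_ * _).
  rewrite -[in X in _ * X](subnKC ci) addnC exprD mulrA /dy -exprMn mulVf //.
  by rewrite expr1n mul1r.
by rewrite ler_wpM2l // exprn_ge0.
Qed.

End Lengths.

(** [side] and each digit of [Y] depend on finitely many digits of the code, whence their
    continuity. The map [p] writes [y0] in the non-square positions and [y1], [y2] in the square
    ones; the point determines [y0] with every Hoelder exponent below [s], on either half of [D]. *)
Lemma cantor_set_exists s x0 kappa : 0 < s <= 1 -> 0 < kappa ->
  exists (D : set R) (side : R -> bool) (Y : bool -> R -> R),
  [/\ [/\ D !=set0, closed D & D `<=` seg x0 (x0 + kappa)],
    exists K : R, forall r, 0 < r <= 1 -> exists (T : finType) (c : T -> R),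
      #|T|%:R * powR r s <= K /\ forall x, D x -> exists j : T, c j <= x <= c j + r,
    [/\ forall h x, 0 <= Y h x <= 1, forall h, cont_in D (Y h) &
      forall x, D x -> exists2 d : R, 0 < d &
        forall y, D y -> `|x - y| < d -> side x = side y] &
    forall b eta, 0 < eta < s -> exists2 K : R, 0 < K & exists p : R -> R -> R -> R,
      (forall y0 y1 y2, 0 <= y0 <= 1 -> 0 <= y1 <= 1 -> 0 <= y2 <= 1 ->
        [/\ D (p y0 y1 y2), side (p y0 y1 y2) = b, Y false (p y0 y1 y2) = y1 &
          Y true (p y0 y1 y2) = y2]) /\
      (forall y0 y1 y2 z0 z1 z2, 0 <= y0 <= 1 -> 0 <= y1 <= 1 -> 0 <= y2 <= 1 ->
        0 <= z0 <= 1 -> 0 <= z1 <= 1 -> 0 <= z2 <= 1 ->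
        `|y0 - z0| <= K * powR `|p y0 y1 y2 - p z0 z1 z2| eta)].
Proof.
move=> s01 kappa0.
pose len := clen s kappa.
have len0 : forall n, 0 <= len n by exact: clen_ge0.
have lenS : forall n, len n.+1 <= len n by exact: clen_le.
have gap0 : forall n, 0 < len n - 2 * len n.+1 by exact: clen_gap_gt0.
pose D := cantor len x0.
have hcode x : exists e, D x -> forall n, cyl len x0 n e x.
  have [Dx|nDx] := pselect (D x); last by exists xpred0.
  by have [e he] := cantor_code lenS gap0 Dx; exists e.
have [code codeP] := choice hcode.
have near_code n : exists2 d : R, 0 < d & forall x y, D x -> D y -> `|x - y| < d ->
    agree n (code x) (code y).
  have [d d0 hd] := cantor_near lenS gap0 n.
  by exists d => // x y Dx Dy; apply: hd; [exact: codeP Dx n|exact: codeP Dy n].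
pose side x := code x 0%N.
pose Y h x := bval (dy R) (value_digits h (code x)).
exists D, side, Y; split; first split.
- by exists (x0 + bval len xpred0); exact: cantor_bval.
- exact: closed_cantor.
- move=> x /(_ 0%N)[e]; rewrite /cyl /psum big_ord0 addr0 /seg /= /len /clen expr0.
  by rewrite divr1 mulr1.
- exists (1 + 2 * powR kappa s) => r r01; have [n [nr hn]] := clen_cover s01 kappa0 r01.
  exists (n.-tuple bool), (fun t : n.-tuple bool => x0 + psum len (nth false t) n); split.
    by rewrite card_tuple card_bool.
  move=> x /(_ n)[e /cyl_tuple[t /andP[? ?]]]; exists t.
  by apply/andP; split => //; move: nr; rewrite -/(len n); lra.
- split; first by move=> h x; exact: bval_dy01.
  + move=> h x Dx e e0; have [n ne] := dy_small e0.
    have [d d0 hd] := near_code ((n.*2.+1 + h) ^ 2)%N; exists d => // y Dy xy.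
    apply: le_lt_trans ne; apply: bval_agree; [exact: dy_ge0|exact: dy_le|].
    move=> i ni; apply: hd => //; rewrite ltn_exp2r //; lia.
  + move=> x Dx; have [d d0 hd] := near_code 1%N; exists d => // y Dy xy.
    exact: hd.
move=> b eta etas; have [K K0 hK] := clen_hoelder s01 kappa0 etas.
exists K => //.
(* Binary digits as a function of [y], with the zero sequence outside [0, 1]. *)
have [dig digP] := choice (fun y => let P := pselect (0 <= y <= 1) in
   match P return (exists d, 0 <= y <= 1 -> bval (dy R) d = y) with
   | left h => let: ex_intro d hd := binary_expansion h in ex_intro _ d (fun _ => hd)
   | right h => ex_intro _ xpred0 (fun h' => False_ind _ (h h')) end).
pose enc y0 y1 y2 := encode b (dig y0) (dig y1) (dig y2).
pose p y0 y1 y2 := x0 + bval len (enc y0 y1 y2).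
have Dp y0 y1 y2 : D (p y0 y1 y2) by exact: cantor_bval.
(* Positive gaps make the code of a point unique, so the chosen code is the encoded one. *)
have code_p y0 y1 y2 : code (p y0 y1 y2) =1 enc y0 y1 y2.
  move=> i; have [d d0 hd] := cantor_near lenS gap0 i.+1.
  apply: (hd x0 _ _ (p y0 y1 y2) (p y0 y1 y2)) => //.
  - exact: codeP.
  - exact: cyl_bval.
  - by rewrite subrr normr0.
have bval_ext e e' : e =1 e' -> bval (dy R) e = bval (dy R) e' by move=> /funext->.
exists p; split.
  move=> y0 y1 y2 h0 h1 h2; split => //.
  - by rewrite /side code_p /enc encode0.
  - rewrite /Y -[RHS]digP //; apply: bval_ext => m.
    by rewrite /value_digits code_p; exact: (value_digits_encode false).
  - rewrite /Y -[RHS]digP //; apply: bval_ext => m.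
    by rewrite /value_digits code_p; exact: (value_digits_encode true).
move=> y0 y1 y2 z0 z1 z2 h0 h1 h2 k0 k1 k2.
rewrite -{1}(digP y0) // -{1}(digP z0) //.
have dig_agree n : agree n (enc y0 y1 y2) (enc z0 z1 z2) ->
    `|bval (dy R) (dig y0) - bval (dy R) (dig z0)| <= dy R (n - sqc n).
  by move=> /encode_agree; apply: bval_agree; [exact: dy_ge0|exact: dy_le].
have [all_agree|] := pselect (forall n, agree n (enc y0 y1 y2) (enc z0 z1 z2)).
  apply/ler_addgt0Pr => e e0; apply: ler_wpDl.
    by rewrite mulr_ge0 ?powR_ge0 // ltW.
  have [n ne] := dy_small e0.
  (* Below [n.+2 ^ 2] there are at least [n] non-squares. *)
  apply: le_trans (dig_agree _ (all_agree (n.+2 ^ 2)%N)) _; rewrite sqc_sq.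
  apply: le_trans (ltW ne); apply: ler_wiXn2l => //; first by lra.
  by rewrite -mulnn mulSn addKn (leq_trans (leqnSn n)) // leq_pmulr.
move=> /existsNP[n nag].
have [//|[i [_ ag gap_i]]] := cyl_separated lenS (cyl_bval len0 lenS x0 n (enc y0 y1 y2))
  (cyl_bval len0 lenS x0 n (enc z0 z1 z2)).
exact: le_trans (dig_agree i ag) (hK _ _ gap_i).
Qed.

End CantorSet.

(** * Upper bounds for the dimension of graphs *)

Section GraphUpperBound.
Variable R : realType.
Implicit Types (a b x y r t : R) (S D : set R) (g w G : bool -> R -> R).

(** With the length rather than the upper endpoint as second coordinate, the constraint on [g] is a
    mere sign condition and metric sums are coordinatewise. *)
Definition ivf g : R -> set R := fun x => seg (g false x) (g false x + g true x).
Definition graph_on S g : set (R * set R) := [set (x, ivf g x) | x in S].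

(** With [gdist_ivf_ge], the graph metric is bi-Lipschitz to the maximum metric on position, lower
    endpoint and length. *)
Lemma gdist_ivf_le g x y (c : R) : 0 <= g true x -> 0 <= g true y ->
  `|x - y| <= c -> `|g false x - g false y| <= c -> `|g true x - g true y| <= c ->
  gdist (x, ivf g x) (y, ivf g y) <= 3 * c.
Proof.
move=> gx gy h1 h2 h3; rewrite /gdist /=.
suff : hdist (ivf g x) (ivf g y) <= 2 * c by lra.
have c0 : 0 <= c by apply: le_trans h1.
apply: hdist_seg_le; [lra|lra|lra|].
by rewrite opprD addrACA; apply: le_trans (ler_normD _ _) _; lra.
Qed.

Lemma gdist_ivf_ge g x y : 0 <= g true x -> 0 <= g true y ->
  let r := gdist (x, ivf g x) (y, ivf g y) in
  [/\ `|x - y| <= r, `|g false x - g false y| <= r &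
    `|g true x - g true y| <= 2 * r].
Proof.
move=> gx gy; rewrite /gdist /=.
have [|| h1 h2] := @le_hdist_seg R (g false x) (g false x + g true x)
  (g false y) (g false y + g true y); [lra|lra|].
rewrite -/(ivf g x) -/(ivf g y) in h1 h2.
move: (hdist _ _) h1 h2 => h h1 h2.
have := normr_ge0 (x - y); have := normr_ge0 (g false x - g false y) => n1 n2.
split; [lra|lra|].
have -> : g true x - g true y = (g false x + g true x - (g false y + g true y)) -
  (g false x - g false y) by ring.
by apply: le_trans (ler_normB _ _) _; lra.
Qed.

(** Over an interval of length [r = rad L n], a smooth coordinate varies by at most a multiple of
    [(L + 2) * r] and needs of order [B] steps of height [r]; a rough one needs of order [1 / r],
    which the factor [powR r 1] offsets. *)
Lemma osc_boxes S g (M : R) rough n : good_on S rough g ->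
  (forall i x, S x -> `|g i x| <= M) -> 0 <= M ->
  exists B : R, [/\ 2 <= B, n%:R <= B & let r := B^-1 ^+ n.+1 in forall i,
    exists k : nat, k.+1%:R * powR r (rough i)%:R <= (2 * M + 5) * B /\
    forall c, exists m, forall x, S x -> c <= x <= c + r ->
      m <= g i x <= m + k.+1%:R * r].
Proof.
move=> gS gM M0; have [L [G [L0 hG]]] := gS n.
pose B := L + n%:R + 2; have n0 : 0 <= n%:R :> R by [].
have B2 : 2 <= B by rewrite /B; lra.
exists B; split => //; first by rewrite /B; lra.
move=> r i.
have r0 : 0 < r by rewrite exprn_gt0 // invr_gt0; lra.
have r1 : r <= 1 by rewrite exprn_ile1 ?invr_ge0 ?invf_le1; lra.
have ceil (u : R) : 0 <= u -> exists k : nat, u <= k.+1%:R <= u + 1.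
  move=> u0; exists (Num.truncn u).
  by have /andP[h1 h2] := truncn_itv u0; rewrite (ltW h2) -natr1 lerD2r.
case ri : (rough i).
  have [|k /andP[k1 k2]] := ceil (2 * M / r); first by rewrite divr_ge0 ?mulr_ge0 // ltW.
  exists k; split.
    rewrite powRr1 ?(ltW r0) //.
    apply: (@le_trans _ _ ((2 * M / r + 1) * r)); first by rewrite ler_wpM2r // ltW.
    rewrite mulrDl divfK ?gt_eqF // mul1r.
    have : 0 <= (2 * M + 5) * (B - 1) by rewrite mulr_ge0 //; lra.
    by lra.
  move=> c; exists (- M) => x Sx _; have := gM i x Sx; rewrite ler_norml => /andP[h1 h2].
  by rewrite h1 /=; rewrite ler_pdivrMr // in k1; lra.
have [|lG wG] := hG i; first by rewrite ri.
have [|k /andP[k1 k2]] := ceil (2 * (L + 2)); first by lra.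
exists k; split.
  rewrite powRr0 mulr1; apply: le_trans k2 _.
  have : 0 <= (2 * M) * B by rewrite !mulr_ge0 //; lra.
  by rewrite /B; lra.
move=> c.
have [[p [Sp p12]]|none] := pselect (exists p, S p /\ c <= p <= c + r); last first.
  by exists 0 => x Sx xc; exfalso; apply: none; exists x.
move: p12 => /andP[p1 p2].
exists (g i p - (L + 2) * r) => x Sx /andP[x1 x2].
have h1 := wG x Sx; have h2 := wG p Sp; have h3 := lG x p Sx Sp.
rewrite /rad -/B -/r in h1 h2.
have h4 : L * `|x - p| <= L * r by rewrite ler_wpM2l // ler_norml; lra.
have : 2 * (L + 2) * r <= k.+1%:R * r by rewrite ler_wpM2r // ltW.
move: h1 h2 (le_trans h3 h4); rewrite !ler_norml => /andP[? ?] /andP[? ?] /andP[? ?] ?.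
lra.
Qed.

Lemma subdivide (m r v : R) k : m <= v <= m + k.+1%:R * r ->
  exists i : 'I_k.+1, m + i%:R * r <= v <= m + i%:R * r + r.
Proof.
elim: k => [|k IH]; first by exists ord0; rewrite mul0r addr0 -[X in _ <= m + X]mul1r.
move=> /andP[mv vm]; have [h|h] := leP v (m + k.+1%:R * r).
  by have [|i hi] := IH; [rewrite mv|exists (widen_ord (leqnSn _) i)].
by exists ord_max; rewrite /= (ltW h) /=; move: vm; rewrite -natr1; lra.
Qed.

(** The number of boxes of size [r] is at most a constant times [B ^ 2 * r ^ -tau], while
    [r ^ (t - tau) <= B ^ -3]; the total is of order [1 / B]. *)
Lemma graph_null S g rough (sigma t M : R) : 0 < t ->
  (exists K : R, forall r, 0 < r <= 1 -> exists (T : finType) (c : T -> R),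
     #|T|%:R * powR r sigma <= K /\ forall x, S x -> exists j : T, c j <= x <= c j + r) ->
  (forall x, S x -> 0 <= g true x) ->
  good_on S rough g -> (forall i x, S x -> `|g i x| <= M) ->
  sigma + (rough false)%:R + (rough true)%:R < t ->
  null_cover (@gdist R) t (graph_on S g).
Proof.
move=> t0 [K0 cov] g0 gS gM lt_t.
have {gM} [M0 [M0_ge0 gM]] : exists M0, 0 <= M0 /\ forall i x, S x -> `|g i x| <= M0.
  exists (Num.max M 0); split; first by rewrite le_max lexx orbT.
  by move=> i x Sx; rewrite le_max gM.
pose K := Num.max K0 1.
have K1 : 1 <= K by rewrite le_max lexx orbT.
have KK : K0 <= K by rewrite le_max lexx.
pose A := 2 * M0 + 5; have A0 : 0 < A by rewrite /A; lra.
pose C := K * A ^+ 2 * powR 3 t.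
have C0 : 0 < C by rewrite !mulr_gt0 ?exprn_gt0 ?powR_gt0 //; lra.
apply: null_cover_finite => // e e0.
set tau := sigma + _ + _ in lt_t.
(* The first entry gives [(n + 1) * (t - tau) >= 3]; the second makes [B >= n] exceed [C / e] and
   [3 / e], for the total and the diameter. *)
pose n := maxn (Num.truncn (3 / (t - tau))) (Num.truncn (Num.max (C / e) (3 / e))).+1.
have n1 : 3 <= n.+1%:R * (t - tau).
  rewrite -ler_pdivrMr ?subr_gt0 //; apply: le_trans (ltW (truncnS_gt _)) _.
  by rewrite ler_nat ltnS leq_maxl.
have : Num.max (C / e) (3 / e) < n%:R.
  by apply: lt_le_trans (truncnS_gt _) _; rewrite ler_nat leq_maxr.
rewrite gt_max => /andP[n2 n3].
have [B [B2 nB hB]] := osc_boxes n gS gM M0_ge0.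
pose r := B^-1 ^+ n.+1; rewrite -/r in hB.
have B0 : 0 < B by lra.
have r0 : 0 < r by rewrite exprn_gt0 // invr_gt0.
have r1 : r <= 1 by rewrite exprn_ile1 ?invr_ge0 ?invf_le1; lra.
have rB : r <= B^-1.
  rewrite -[leRHS]expr1; apply: ler_wiXn2l => //; first by rewrite invr_ge0 ltW.
  by rewrite invf_le1 //; lra.
have r3e : 3 * r < e.
  have : B^-1 < e / 3.
    by rewrite -[ltRHS]invrK invf_div ltf_pV2 ?posrE ?divr_gt0 // (lt_le_trans n3).
  by lra.
have [|T [c [cardT hT]]] := cov r; first by rewrite r0.
have [k0 [hk0 osc0]] := hB false.
have [m0 hm0] := choice (fun j : T => osc0 (c j)).
have [k1 [hk1 osc1]] := hB true.
have [m1 hm1] := choice (fun j : T => osc1 (c j)).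
pose U (p : T * ('I_k0.+1 * 'I_k1.+1)) : set (R * set R) :=
  [set (x, ivf g x) | x in [set x | S x /\ [/\ c p.1 <= x <= c p.1 + r,
    m0 p.1 + p.2.1%:R * r <= g false x <= m0 p.1 + p.2.1%:R * r + r &
    m1 p.1 + p.2.2%:R * r <= g true x <= m1 p.1 + p.2.2%:R * r + r]]].
exists (3 * r), (T * ('I_k0.+1 * 'I_k1.+1))%type, U; split.
- by rewrite r3e andbT mulr_gt0.
- move=> _ [x Sx <-]; have [j xj] := hT x Sx.
  have [i0 hi0] := subdivide (hm0 j x Sx xj).
  have [i1 hi1] := subdivide (hm1 j x Sx xj).
  by exists (j, (i0, i1)) => //; exists x.
- move=> p u v [x [Sx [/andP[? ?] /andP[? ?] /andP[? ?]]] <-].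
  move=> [y [Sy [/andP[? ?] /andP[? ?] /andP[? ?]]] <-].
  by apply: gdist_ivf_le; rewrite ?g0 // ler_norml; lra.
rewrite !card_prod !card_ord !natrM powRM ?(ltW r0) //.
have -> : powR r t = powR r sigma * powR r (rough false)%:R * powR r (rough true)%:R *
    powR r (t - tau).
  rewrite -!powRD ?(gt_eqF r0) ?implybT //; congr powR; rewrite /tau; lra.
have rt : powR r (t - tau) <= (B ^+ 3)^-1.
  rewrite /r -[_ ^+ n.+1]powR_mulrn ?invr_ge0 ?(ltW B0) // -powRrM.
  rewrite -[B^-1]powR_inv1 ?(ltW B0) // -powRrM mulN1r powRN.
  rewrite lef_pV2 ?posrE ?exprn_gt0 ?powR_gt0 //.
  by rewrite -[B ^+ 3]powR_mulrn ?(ltW B0) // ler_powR //; lra.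
have P0 u : 0 <= powR r u by exact: powR_ge0.
have step1 : #|T|%:R * powR r sigma * (k0.+1%:R * powR r (rough false)%:R) *
   (k1.+1%:R * powR r (rough true)%:R) * powR r (t - tau) <= K * (A * B) * (A * B) * (B ^+ 3)^-1.
  rewrite -/A in hk0 hk1; have cardK := le_trans cardT KK.
  apply: ler_pM => //; first by rewrite !mulr_ge0.
  apply: ler_pM => //; try by rewrite !mulr_ge0.
  by apply: ler_pM => //; rewrite mulr_ge0.
apply: (@le_trans _ _ (K * (A * B) * (A * B) * (B ^+ 3)^-1 * powR 3 t)).
  apply: le_trans (ler_wpM2r (powR_ge0 3 t) step1).
  by rewrite le_eqVlt; apply/orP; left; apply/eqP; ring.
have -> : K * (A * B) * (A * B) * (B ^+ 3)^-1 * powR 3 t = C / B.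
  by rewrite /C; field; rewrite gt_eqF.
by rewrite ler_pdivrMr // mulrC -ler_pdivrMr // ltW // (lt_le_trans n2).
Qed.

Lemma seg_cover a b : a <= b -> exists K : R, forall r, 0 < r <= 1 ->
  exists (T : finType) (c : T -> R), #|T|%:R * powR r 1 <= K /\
    forall x, seg a b x -> exists j : T, c j <= x <= c j + r.
Proof.
move=> ab; exists (b - a + 1) => r /andP[r0 r1].
pose k := Num.truncn ((b - a) / r).
have /andP[k1 k2] : k%:R <= (b - a) / r < k.+1%:R.
  by apply: truncn_itv; rewrite divr_ge0 ?subr_ge0 // ltW.
exists 'I_k.+1, (fun i : 'I_k.+1 => a + i%:R * r); split.
  rewrite card_ord powRr1 ?(ltW r0) // -natr1 mulrDl mul1r.
  by rewrite lerD // -ler_pdivlMr.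
move=> x /andP[ax xb]; have [|i hi] := @subdivide a r x k; last by exists i.
by rewrite ax; rewrite ltr_pdivrMr // in k2; lra.
Qed.

(** The constant grows by [L]; using the approximation of [w] at an index larger by at least [L]
    makes its error small enough for the new constant. *)
Lemma good_onD S w psi (L : R) : good_on S xpred0 w -> 0 <= L ->
  (forall i x y, S x -> S y -> `|psi i x - psi i y| <= L * `|x - y|) ->
  good_on S xpred0 (fun i x => w i x + psi i x).
Proof.
move=> gw L0 hpsi n.
pose N := (n + (Num.truncn L).+1)%N.
have LN : L <= (Num.truncn L).+1%:R by exact/ltW/truncnS_gt.
have [L1 [G [L10 hG]]] := gw N.
exists (L1 + L), (fun i x => G i x + psi i x); split; first exact: addr_ge0.
move=> i _; have [lG wG] := hG i isT; split.
  move=> x y Sx Sy; rewrite opprD addrACA; apply: le_trans (ler_normD _ _) _.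
  by rewrite mulrDl; apply: lerD; [exact: lG|exact: hpsi].
move=> x Sx; rewrite opprD addrACA subrr addr0; apply: le_trans (wG x Sx) _.
apply: le_rad; rewrite ?addr_ge0 ?leq_addr // /N natrD; lra.
Qed.

End GraphUpperBound.

(** * Exact dimension of graphs rough over a Cantor set *)

Section Dimension.
Variable R : realType.
Implicit Types (a b x y t beta : R) (S D : set R) (g w : bool -> R -> R).

Lemma hdim_le (X : Type) (d : X -> X -> R) E beta : 0 <= beta ->
  (forall t, beta < t -> null_cover d t E) -> (hdim d E <= beta%:E)%E.
Proof.
move=> b0 h; apply/lee_addgt0Pr => e e0; rewrite -EFinD.
have be : beta < beta + e by rewrite ltrDl.
apply: ereal_inf_lbound; exists (beta + e) => //; split.
  exact: le_lt_trans be.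
exact/Hmeasure0P/h.
Qed.

Lemma le_hdim (X : Type) (d : X -> X -> R) E beta :
  (forall t, 0 < t < beta -> ~ null_cover d t E) -> (beta%:E <= hdim d E)%E.
Proof.
move=> h; apply: le_ereal_inf_tmp => _ [t [t0 /Hmeasure0P nt] <-].
rewrite lee_fin leNgt; apply/negP => tb; apply: h nt; exact/andP.
Qed.

Lemma cont_on_ivf a b g : (forall x, a <= x <= b -> 0 <= g true x) ->
  (forall i, cont_on a b (g i)) -> CK a b (ivf g).
Proof.
move=> g0 cg; split.
  by move=> x xab; apply: seg_Kc; have := g0 x xab; lra.
move=> x xab e e0; have e2 : 0 < e / 3 by rewrite divr_gt0.
have [d d0 hd] := cg false x xab _ e2; have [d' d'0 hd'] := cg true x xab _ e2.
exists (Num.min d d'); first by rewrite lt_min d0.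
move=> y yab; rewrite lt_min => /andP[/(hd _ yab) h1 /(hd' _ yab) h2].
have gx := g0 x xab; have gy := g0 y yab.
apply: (@le_lt_trans _ _ (2 * (e / 3))); last by lra.
apply: hdist_seg_le; [lra|lra|lra|].
by rewrite opprD addrACA; apply: le_trans (ler_normD _ _) _; lra.
Qed.

Lemma good_on_sub S S' (rough : bool -> bool) w g : S' `<=` S ->
  (forall i, ~~ rough i -> forall x, S' x -> g i x = w i x) ->
  good_on S xpred0 w -> good_on S' rough g.
Proof.
move=> SS gw hw n; have [L [G [L0 hG]]] := hw n.
exists L, G; split => // i ri; have [lG wG] := hG i isT; split.
  by move=> x y Sx Sy; apply: lG; exact: SS.
by move=> x Sx; rewrite gw //; apply: wG; exact: SS.
Qed.

(** Countable stability: the graph over [D] is null by the box count, and over each set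
    [far D a b m] it has dimension at most 1, below [t]. *)
Lemma null_cover_ivf a b t D g (sigma : R) rough : a <= b -> 1 < t -> closed D ->
  D `<=` seg a b ->
  (exists K : R, forall r, 0 < r <= 1 -> exists (T : finType) (c : T -> R),
     #|T|%:R * powR r sigma <= K /\
     forall x, D x -> exists j : T, c j <= x <= c j + r) ->
  (forall x, a <= x <= b -> 0 <= g true x) -> (forall i, cont_on a b (g i)) ->
  (forall m, good_on (far D a b m) xpred0 g) -> good_on D rough g ->
  sigma + (rough false)%:R + (rough true)%:R < t ->
  null_cover (@gdist R) t (graph_on (seg a b) g).
Proof.
move=> ab t1 cD Dab covD g0 cg gfar gD lt_t.
have t0 : 0 < t by lra.
have [M1 _ hM1] := cont_on_bounded (cg false).
have [M2 _ hM2] := cont_on_bounded (cg true).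
have gM i x : seg a b x -> `|g i x| <= Num.max M1 M2.
  by move=> xab; rewrite le_max; case: i; rewrite ?hM1 ?hM2 ?orbT.
pose E m := if m is m'.+1 then graph_on (far D a b m') g else graph_on D g.
apply: (@null_coverS _ _ _ _ _ (\bigcup_m E m)).
  move=> _ [x xab <-]; have [Dx|nDx] := pselect (D x).
    by exists 0%N => //; exists x.
  by have [m fm] := far_cover cD xab nDx; exists m.+1 => //; exists x.
apply: null_cover_bigcup => -[|m] /=.
  apply: (@graph_null _ _ _ rough sigma _ (Num.max M1 M2)) => //.
    by move=> x /Dab; exact: g0.
  by move=> i x /Dab; exact: gM.
apply: (@graph_null _ _ _ xpred0 1 _ (Num.max M1 M2)) => //.
- have [K hK] := seg_cover ab; exists K => r /hK[T [c [h1 h2]]].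
  by exists T, c; split => // x [/h2].
- by move=> x [/g0].
- by move=> i x [xab _]; exact: gM.
- by rewrite /= !addr0.
Qed.

(** The point of the graph determines [y0], [y1], [y2] with exponents [eta], 1 and [k]. For
    [k = false] the third exponent is 0 and its condition is mere boundedness. *)
Lemma not_null_cover_ivf a b t D g (s : R) (k : bool) (A c : R) : 0 < s -> D `<=` seg a b ->
  (forall x, a <= x <= b -> 0 <= g true x) -> 0 < c ->
  (forall eta, 0 < eta < s -> exists2 K : R, 0 < K & exists p : R -> R -> R -> R,
    (forall y0 y1 y2, 0 <= y0 <= 1 -> 0 <= y1 <= 1 -> 0 <= y2 <= 1 ->
      [/\ D (p y0 y1 y2), g false (p y0 y1 y2) = y1 &
        k -> g true (p y0 y1 y2) = A + c * y2]) /\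
    (forall y0 y1 y2 z0 z1 z2, 0 <= y0 <= 1 -> 0 <= y1 <= 1 -> 0 <= y2 <= 1 ->
      0 <= z0 <= 1 -> 0 <= z1 <= 1 -> 0 <= z2 <= 1 ->
      `|y0 - z0| <= K * powR `|p y0 y1 y2 - p z0 z1 z2| eta)) ->
  0 < t < s + 1 + k%:R -> ~ null_cover (@gdist R) t (graph_on (seg a b) g).
Proof.
move=> s0 Dab g0 c0 hp /andP[t0 ts].
(* Close enough to [s] for [t <= eta + 1 + k], with [s / 2] ensuring positivity. *)
pose eta := Num.max (s / 2) (s - (s + 1 + k%:R - t)).
have eta_s : 0 < eta < s by rewrite lt_max gt_max; lra.
have eta_t : t <= eta + 1 + k%:R.
  have : s - (s + 1 + k%:R - t) <= eta by rewrite le_max lexx orbT.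
  by lra.
have [K K0 [p [pD pH]]] := hp eta eta_s.
have e0 : 0 <= eta by case/andP: eta_s => /ltW.
have c2 : 0 < 2 / c by rewrite divr_gt0.
apply: (@not_null_cover_cube R _ _ _ (fun y0 y1 y2 => (p y0 y1 y2, ivf g (p y0 y1 y2)))
  (* [K] serves [y0], 1 serves [y1] and the bounded [y2] when [k = false], and [2 / c] serves [y2]
     read off from the length. *)
  (K + 1 + 2 / c) eta 1 k%:R) => //; first by lra.
- by rewrite t0.
- move=> y0 y1 y2 h0 h1 h2; exists (p y0 y1 y2) => //.
  by have [/Dab] := pD _ _ _ h0 h1 h2.
move=> y0 y1 y2 z0 z1 z2 h0 h1 h2 k0 k1 k2.
have [Dp gp1 gp2] := pD _ _ _ h0 h1 h2; have [Dq gq1 gq2] := pD _ _ _ k0 k1 k2.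
have H := pH _ _ _ _ _ _ h0 h1 h2 k0 k1 k2.
move: (p y0 y1 y2) (p z0 z1 z2) Dp Dq gp1 gp2 gq1 gq2 H => u v Dp Dq gp1 gp2 gq1 gq2 H.
have [d1 d2 d3] := gdist_ivf_ge (g0 _ (Dab _ Dp)) (g0 _ (Dab _ Dq)).
move: (gdist _ _) d1 d2 d3 => r d1 d2 d3.
have r0 : 0 <= r by exact: le_trans (normr_ge0 _) d1.
split => //; split.
- apply: le_trans H _.
  have h : powR `|u - v| eta <= powR r eta by apply: ge0_ler_powR; rewrite ?nnegrE.
  have := powR_ge0 r eta => h'; apply: (@le_trans _ _ (K * powR r eta)).
    by rewrite ler_wpM2l // ltW.
  by rewrite ler_wpM2r //; lra.
- rewrite powRr1 // -gp1 -gq1; apply: le_trans d2 _.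
  have : 0 <= (K + 2 / c) * r by rewrite mulr_ge0 //; lra.
  by lra.
- case: k {hp pD pH ts eta eta_s eta_t e0 H} gp2 gq2 => gp2 gq2 /=.
    rewrite powRr1 //.
    have e : c * (y2 - z2) = g true u - g true v by rewrite gp2 // gq2 //; lra.
    have : c * `|y2 - z2| <= 2 * r by rewrite -[c in X in X <= _]gtr0_norm // -normrM e.
    rewrite -ler_pdivlMl // => h; apply: le_trans h _.
    have : 0 <= (K + 1) * r by rewrite mulr_ge0 //; lra.
    rewrite mulrA [c^-1 * 2]mulrC; lra.
  by rewrite powRr0 mulr1 ler_norml; lra.
Qed.

Lemma Dbeta_ivf a b D g (s : R) (k : bool) (A c : R) : a <= b -> 0 < s -> closed D ->
  D `<=` seg a b ->
  (exists K : R, forall r, 0 < r <= 1 -> exists (T : finType) (c : T -> R),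
     #|T|%:R * powR r s <= K /\
     forall x, D x -> exists j : T, c j <= x <= c j + r) ->
  (forall x, a <= x <= b -> 0 <= g true x) -> (forall i, cont_on a b (g i)) ->
  (forall m, good_on (far D a b m) xpred0 g) ->
  good_on D (fun i => ~~ i || k) g -> 0 < c ->
  (forall eta, 0 < eta < s -> exists2 K : R, 0 < K & exists p : R -> R -> R -> R,
    (forall y0 y1 y2, 0 <= y0 <= 1 -> 0 <= y1 <= 1 -> 0 <= y2 <= 1 ->
      [/\ D (p y0 y1 y2), g false (p y0 y1 y2) = y1 &
        k -> g true (p y0 y1 y2) = A + c * y2]) /\
    (forall y0 y1 y2 z0 z1 z2, 0 <= y0 <= 1 -> 0 <= y1 <= 1 -> 0 <= y2 <= 1 ->
      0 <= z0 <= 1 -> 0 <= z1 <= 1 -> 0 <= z2 <= 1 ->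
      `|y0 - z0| <= K * powR `|p y0 y1 y2 - p z0 z1 z2| eta)) ->
  Dbeta a b (s + 1 + k%:R) (ivf g).
Proof.
move=> ab s0 cD Dab covD g0 cg gfar gD c0 hp; split; first exact: cont_on_ivf.
have k0 : 0 <= k%:R :> R by [].
apply/eqP; rewrite eq_le; apply/andP; split.
  apply: hdim_le => [|t t_gt]; first by lra.
  by apply: (null_cover_ivf ab _ cD Dab covD g0 cg gfar gD); rewrite //=; lra.
by apply: le_hdim => t; apply: (not_null_cover_ivf s0 Dab g0 c0 hp).
Qed.

(** Truncation of [v] to [-u, u] for [u >= 0]; it will keep the correction of the lengths within
    [q / 2]. *)
Definition clamp (u v : R) := Num.max (- u) (Num.min u v).

Lemma clamp_sub (u v u' v' : R) : `|clamp u v - clamp u' v'| <= `|u - u'| + `|v - v'|.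
Proof.
have h1 := ler_norm (u - u'); have h2 := ler_norm (u' - u); rewrite distrC in h2.
have h3 := ler_norm (v - v'); have h4 := ler_norm (v' - v); rewrite distrC in h4.
move: `|u - u'| `|v - v'| h1 h2 h3 h4 => p q h1 h2 h3 h4.
rewrite /clamp ler_norml; case: (leP u v) => ?; case: (leP u' v') => ?.
- by case: (leP (- u) u) => ?; case: (leP (- u') u') => ?; lra.
- by case: (leP (- u) u) => ?; case: (leP (- u') v') => ?; lra.
- by case: (leP (- u) v) => ?; case: (leP (- u') u') => ?; lra.
- by case: (leP (- u) v) => ?; case: (leP (- u') v') => ?; lra.
Qed.

Lemma clamp_bounds (u v : R) : 0 <= u -> - u <= clamp u v <= u.
Proof.
by move=> u0; rewrite /clamp le_max lexx /= ge_max ge_min lexx andbT; lra.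
Qed.

Lemma clamp_id (u v : R) : `|v| <= u -> clamp u v = v.
Proof.
by rewrite ler_norml => /andP[h1 h2]; rewrite /clamp (min_idPr h2) (max_idPr h1).
Qed.

Lemma cont_onD a b (F G : R -> R) (H : R -> R) : cont_on a b F -> cont_on a b G ->
  (forall x y, `|H x - H y| <= `|F x - F y| + `|G x - G y|) -> cont_on a b H.
Proof.
move=> cF cG hH x xab e e0; have e2 : 0 < e / 2 by rewrite divr_gt0.
have [d d0 hd] := cF x xab _ e2; have [d' d'0 hd'] := cG x xab _ e2.
exists (Num.min d d'); first by rewrite lt_min d0.
move=> y yab; rewrite lt_min => /andP[/(hd _ yab) h1 /(hd' _ yab) h2].
by apply: le_lt_trans (hH x y) _; lra.
Qed.

Lemma cont_inD D (F G H : R -> R) (C : R) : 0 <= C -> cont_in D F -> cont_in D G ->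
  (forall x y, `|H x - H y| <= C * (`|F x - F y| + `|G x - G y|)) -> cont_in D H.
Proof.
move=> C0 cF cG hH x Dx e e0.
have e2 : 0 < e / (2 * (C + 1)) by rewrite divr_gt0 // mulr_gt0 //; lra.
have [d d0 hd] := cF x Dx _ e2; have [d' d'0 hd'] := cG x Dx _ e2.
exists (Num.min d d'); first by rewrite lt_min d0.
move=> y Dy; rewrite lt_min => /andP[/(hd _ Dy) h1 /(hd' _ Dy) h2].
apply: le_lt_trans (hH x y) _.
have C1 : C * (`|F x - F y| + `|G x - G y|) <= (C + 1) * (`|F x - F y| + `|G x - G y|).
  by rewrite ler_wpM2r ?addr_ge0 //; lra.
apply: le_lt_trans C1 _; rewrite -ltr_pdivlMl; last by lra.
have -> : (C + 1)^-1 * e = e / (2 * (C + 1)) + e / (2 * (C + 1)).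
  by field; rewrite gt_eqF //; lra.
exact: ltrD.
Qed.

Lemma cont_in_if D (side : R -> bool) (F G : R -> R) :
  (forall x, D x -> exists2 d : R, 0 < d &
    forall y, D y -> `|x - y| < d -> side x = side y) ->
  cont_in D F -> cont_in D G -> cont_in D (fun x => if side x then F x else G x).
Proof.
move=> hs cF cG x Dx e e0; have [d d0 hd] := hs x Dx.
have [d1 d10 hd1] := cF x Dx _ e0; have [d2 d20 hd2] := cG x Dx _ e0.
exists (Num.min d (Num.min d1 d2)); first by rewrite !lt_min d0 d10.
move=> y Dy; rewrite !lt_min => /and3P[/(hd _ Dy) <- /(hd1 _ Dy) h1 /(hd2 _ Dy) h2].
by case: ifP.
Qed.

Lemma cont_on_in a b D (F : R -> R) : D `<=` seg a b -> cont_on a b F -> cont_in D F.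
Proof.
move=> Dab cF x Dx e e0; have [d d0 hd] := cF x (Dab x Dx) e e0.
by exists d => // y /Dab; exact: hd.
Qed.

End Dimension.

(** * Coordinates of [f] and consequences of its dimension *)

Section Decomposition.
Variable R : realType.
Implicit Types (a b x y : R) (F w z : bool -> R -> R).

Lemma CK_coordinates a b (f : R -> set R) : CK a b f -> exists F,
  [/\ forall i, cont_on a b (F i), forall x, a <= x <= b -> 0 <= F true x &
    forall x, a <= x <= b -> f x = ivf F x].
Proof.
move=> [fK fc].
have ex x : exists p : R * R, a <= x <= b -> 0 <= p.2 /\ f x = seg p.1 (p.1 + p.2).
  have [xab|nx] := boolP (a <= x <= b); last by exists (0, 0).
  have [u [v [uv fuv]]] := Kc_seg (fK x xab).
  by exists (u, v - u) => _ /=; rewrite addrCA subrr addr0 subr_ge0.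
have [p hp] := choice ex.
pose F (i : bool) x := if i then (p x).2 else (p x).1.
have F0 x : a <= x <= b -> 0 <= F true x by move=> /hp[].
have fF x : a <= x <= b -> f x = ivf F x by move=> /hp[].
exists F; split => // i x xab e e0.
have e2 : 0 < e / 2 by rewrite divr_gt0.
have [d d0 hd] := fc x xab _ e2; exists d => // y yab xy.
have h := hd y yab xy; rewrite !fF // in h.
have [|| h1 h2] := @le_hdist_seg R (F false x) (F false x + F true x)
  (F false y) (F false y + F true y).
- by have := F0 x xab; lra.
- by have := F0 y yab; lra.
rewrite -/(ivf F x) -/(ivf F y) in h1 h2.
have {}h1 := le_lt_trans h1 h; have {h}h2 := le_lt_trans h2 h.
case: i; last by lra.
have -> : F true x - F true y = (F false x + F true x - (F false y + F true y)) -
  (F false x - F false y) by ring.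
by apply: le_lt_trans (ler_normB _ _) _; lra.
Qed.

Lemma subinterval_near a b x (d : R) : a < b -> a <= x <= b -> 0 < d ->
  exists x0 kappa, 0 < kappa /\
    forall y, seg x0 (x0 + kappa) y -> a <= y <= b /\ `|x - y| < d.
Proof.
move=> ab /andP[ax]; rewrite le_eqVlt => /orP[/eqP xb|xb d0].
  move=> d0; pose k := Num.min (b - a) (d / 2).
  have k0 : 0 < k by rewrite lt_min divr_gt0 // subr_gt0 ab.
  have kb : k <= b - a by rewrite ge_min lexx.
  have kd : k <= d / 2 by rewrite ge_min lexx orbT.
  exists (b - k), k; split => // y /andP[? ?]; split; first by lra.
  by rewrite ltr_norml; lra.
pose k := Num.min (b - x) (d / 2).
have k0 : 0 < k by rewrite lt_min divr_gt0 // subr_gt0 xb.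
have kb : k <= b - x by rewrite ge_min lexx.
have kd : k <= d / 2 by rewrite ge_min lexx orbT.
exists x, k; split => // y /andP[? ?]; split; first by lra.
by rewrite ltr_norml; lra.
Qed.

Lemma dim_graph_le a b F (rough : bool -> bool) (t : R) : a <= b ->
  (forall i, cont_on a b (F i)) -> (forall x, a <= x <= b -> 0 <= F true x) ->
  good_on (seg a b) rough F -> 1 + (rough false)%:R + (rough true)%:R < t ->
  (dimG a b (ivf F) <= t%:E)%E.
Proof.
move=> ab cF F0 gF lt_t.
have [M1 _ hM1] := cont_on_bounded (cF false).
have [M2 _ hM2] := cont_on_bounded (cF true).
have r0 : 0 <= (rough false)%:R :> R by []. 
have r1 : 0 <= (rough true)%:R :> R by [].
apply: hdim_le => [|t' tt']; first by lra.
apply: (@graph_null _ _ _ rough 1 _ (Num.max M1 M2)) => //; [lra| | |lra].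
  exact: seg_cover.
by move=> i x xab; rewrite le_max; case: i; rewrite ?hM1 ?hM2 ?orbT.
Qed.

Lemma dim_graph_le3 a b F (beta : R) : a <= b ->
  (forall i, cont_on a b (F i)) -> (forall x, a <= x <= b -> 0 <= F true x) ->
  (beta%:E <= dimG a b (ivf F))%E -> beta <= 3.
Proof.
move=> ab cF F0 hb; rewrite leNgt; apply/negP => b3.
have : (dimG a b (ivf F) <= ((3 + beta) / 2)%:E)%E.
  apply: (@dim_graph_le _ _ _ xpredT) => //=; last by lra.
  (* When every coordinate is rough, [good_on] imposes no condition on them. *)
  by move=> n; exists 0, F.
by move=> /(le_trans hb); rewrite lee_fin; lra.
Qed.

(** If all lengths vanished, only the lower endpoint would be rough and the dimension would be at
    most 2. *)
Lemma dim_graph_gt2 a b F (beta : R) : a <= b ->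
  (forall i, cont_on a b (F i)) -> (forall x, a <= x <= b -> 0 <= F true x) ->
  (beta%:E <= dimG a b (ivf F))%E -> 2 < beta ->
  exists2 x, a <= x <= b & 0 < F true x.
Proof.
move=> ab cF F0 hb b2; apply: contrapT => none.
have F00 x : a <= x <= b -> F true x = 0.
  move=> xab; apply/eqP; rewrite eq_le F0 // andbT leNgt.
  by apply/negP => Fx; apply: none; exists x.
have : (dimG a b (ivf F) <= ((2 + beta) / 2)%:E)%E.
  apply: (@dim_graph_le _ _ _ negb) => //=; last by lra.
  move=> n; exists 0, (fun _ _ => 0); split => // -[] // _; split => [x y _ _|x /F00->].
    by rewrite subrr normr0 mul0r.
  by rewrite subrr normr0 ltW // rad_gt0.
by move=> /(le_trans hb); rewrite lee_fin; lra.
Qed.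

(* [q] is a Lipschitz lower bound of the length of [f]; half of it goes to each
   summand, which leaves room for a correction of size [q / 2] on both lengths. *)
Lemma lipschitz_minorant a b F (k : bool) : a <= b -> cont_on a b (F true) ->
  (forall x, a <= x <= b -> 0 <= F true x) ->
  (k -> exists2 x, a <= x <= b & 0 < F true x) ->
  exists (q : R -> R) (L : R), [/\ 0 <= L, lip L q,
    forall x, a <= x <= b -> 0 <= q x <= F true x,
    k -> exists2 x, a <= x <= b & 0 < q x & ~~ k -> forall x, q x = 0].
Proof.
move=> ab cF F0; case: k => [|_]; last first.
  exists (fun=> 0), 0; split => // x y; first by rewrite subrr normr0 mul0r.
  by rewrite lexx F0.
move=> /(_ isT)[x0 x0ab Fx0]; have e0 : 0 < F true x0 / 2 by rewrite divr_gt0.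
have l0 : lip 0 (fun=> 0 : R) by move=> x y; rewrite subrr normr0 mul0r.
have [L [q [L0 lq hq]]] := lip_approx ab cF e0 (lexx 0) l0 F0.
exists q, L; split=> //; first by move=> x /hq[].
by move=> _; exists x0 => //; have [_] := hq _ x0ab; lra.
Qed.

Lemma cont_in_target (D : set R) (W Y : R -> R) (A C : R) :
  cont_in D W -> cont_in D Y -> cont_in D (fun x => W x - (A + C * Y x)).
Proof.
move=> cW cY; apply: (@cont_inD _ _ W Y _ (1 + `|C|)) => // x y.
have -> : W x - (A + C * Y x) - (W y - (A + C * Y y)) =
  (W x - W y) - C * (Y x - Y y) by ring.
apply: le_trans (ler_normB _ _) _; rewrite normrM.
have := mulr_ge0 (normr_ge0 C) (normr_ge0 (W x - W y)).
by have := normr_ge0 (Y x - Y y); have := normr_ge0 (W x - W y); lra.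
Qed.

Lemma cont_inN (D : set R) (W : R -> R) : cont_in D W -> cont_in D (fun x => - W x).
Proof.
move=> cW x Dx e e0; have [d d0 hd] := cW x Dx e e0; exists d => // y Dy xy.
by rewrite -opprD normrN; exact: hd.
Qed.

Lemma cont_on_lip a b (W : R -> R) (L : R) : lip L W -> cont_on a b W.
Proof.
move=> lW x xab e e0; have L1 : 0 < `|L| + 1 by rewrite ltr_wpDl.
exists (e / (`|L| + 1)); first exact: divr_gt0.
move=> y _ xy; apply: le_lt_trans (lW x y) _.
apply: (@le_lt_trans _ _ ((`|L| + 1) * `|x - y|)).
  by rewrite ler_wpM2r //; have := ler_norm L; lra.
by rewrite mulrC -ltr_pdivlMr.
Qed.

End Decomposition.

(** * Construction of the two summands *)

Theorem theorem4p19 (R : realType) (a b beta : R) (f : R -> set R) :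
  a < b -> 1 < beta -> CK a b f -> (beta%:E <= dimG a b f)%E ->
  exists g h : R -> set R,
    Dbeta a b beta g /\ Dbeta a b beta h /\
    forall x, a <= x <= b -> f x = oplus (g x) (h x).
Proof.
move=> ab beta1 fCK; have [F [cF F0 fF]] := CK_coordinates fCK.
have ab' := ltW ab.
have -> : dimG a b f = dimG a b (ivf F).
  congr (hdim _ _); apply/seteqP; split => _ [x xab <-]; exists x => //.
    by rewrite fF.
  by rewrite fF.
move=> dimF.
(* As a number, [k] counts the coded coordinates beyond the lower endpoint. *)
pose k := 2 < beta.
have beta3 := dim_graph_le3 ab' cF F0 dimF.
pose s : R := beta - 1 - k%:R.
have s01 : 0 < s <= 1 by rewrite /s /k; case: (ltP 2 beta) => h /=; lra.
have -> : beta = s + 1 + k%:R by rewrite /s; ring.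
have s0 : 0 < s by case/andP: s01.
have [q [Lq [Lq0 lq hq q_pos q_zero]]] :=
  lipschitz_minorant ab' (cF true) F0 (dim_graph_gt2 ab' cF F0 dimF).
have [M0 _ hM0] := cont_on_bounded (cF false).
pose Q (i : bool) x := if i then q x else - M0.
have lQ i : lip Lq (Q i).
  by case: i => // x y; rewrite /Q subrr normr0 mulr_ge0.
have QF i x : a <= x <= b -> Q i x <= F i x.
  move=> xab; case: i; first by have /andP[] := hq x xab.
  by have := hM0 x xab; rewrite ler_norml => /andP[].
have [w [z [wz gw gz]]] := alternating_decomposition ab' cF Lq0 lQ QF.
have cw i := good_on_cont i gw; have cz i := good_on_cont i gz.
(* The Cantor set is placed where, if [k], both lengths are within [c] of constants and
   [q >= 4 * c]. Prescribing a length [A + c * Y] then takes a correction of at most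
   [2 * c <= q / 2]. *)
have [x0 [kappa [Aw [Az [c [kappa0 c0 J_ab hJ]]]]]] : exists x0 kappa Aw Az c,
    [/\ 0 < kappa, 0 < c, seg x0 (x0 + kappa) `<=` seg a b &
      forall x, seg x0 (x0 + kappa) x -> k ->
        [/\ 4 * c <= q x, `|w true x - Aw| <= c & `|z true x - Az| <= c]].
  have [kk|nk] := boolP k; last first.
    by exists a, (b - a), 0, 0, 1; split => //; [lra|rewrite addrCA subrr addr0].
  have [y yab qy] := q_pos kk.
  pose c := q y / 8; have c0 : 0 < c by rewrite divr_gt0.
  have [d1 d10 hd1] := cw true y yab c c0.
  have [d2 d20 hd2] := cz true y yab c c0.
  have L1 : 0 < Lq + 1 by lra.
  have [|x0 [kappa [kappa0 hJ]]] :=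
      @subinterval_near _ a b y (Num.min d1 (Num.min d2 (4 * c / (Lq + 1)))) ab yab.
    by rewrite !lt_min d10 d20 divr_gt0 // mulr_gt0.
  exists x0, kappa, (w true y), (z true y), c; split => // [x /hJ[]//|x Jx _].
  have [xab] := hJ x Jx; rewrite !lt_min => /and3P[h1 h2 h3].
  have u1 := ltW (hd1 x xab h1); have u2 := ltW (hd2 x xab h2).
  rewrite distrC in u1; rewrite distrC in u2; split => //.
  have := lq y x; rewrite ltr_pdivlMr // in h3.
  have := normr_ge0 (y - x); have := ler_norm (q y - q x).
  have -> : q y = 8 * c by rewrite /c; field.
  by move: (Num.norm (y - x)) h3 => u; lra.
have [D [side [Y [[D0 cD DJ] covD [Y01 cY side_loc] lowD]]]] :=
  cantor_set_exists x0 s01 kappa0.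
have Dab : D `<=` seg a b by exact: subset_trans J_ab.
pose C (i : bool) : R := if i then c else 1.
pose Bw (i : bool) : R := if i then Aw else 0.
pose Bz (i : bool) : R := if i then Az else 0.
(* The correction wanted on [D]: added to [w] it yields the coded values where [side] is false,
   subtracted from [z] it yields them where [side] is true. *)
pose T i x := if side x then z i x - (Bz i + C i * Y i x)
  else - (w i x - (Bw i + C i * Y i x)).
have C0 i : 0 < C i by case: i.
have cT i : cont_in D (T i).
  apply: cont_in_if => //.
    by apply: cont_in_target (cY i); exact: cont_on_in Dab (cz i).
  by apply/cont_inN/cont_in_target; [exact: cont_on_in Dab (cw i)|exact: cY].
have [M hM] : exists M : bool -> R, forall i x, D x -> `|T i x| <= M i.
  suff /choice[M hM] : forall i, exists M : R, forall x, D x -> `|T i x| <= M by exists M.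
  move=> i; have [M1 M10 hM1] := cont_on_bounded (cw i).
  have [M2 M20 hM2] := cont_on_bounded (cz i).
  exists (M1 + M2 + `|Bz i| + `|Bw i| + C i) => x Dx; have xab := Dab x Dx.
  have y01 : `|C i * Y i x| <= C i.
    have := Y01 i x; have := C0 i => c1 /andP[y0 y1].
    by rewrite ger0_norm ?mulr_ge0 ?ler_piMr // ltW.
  have := hM1 x xab; have := hM2 x xab; have := normr_ge0 (Bz i); have := normr_ge0 (Bw i).
  rewrite /T; case: ifP => _; rewrite ?normrN => p1 p2 p3 p4.
    by apply: le_trans (ler_normB _ _) _; have := ler_normD (Bz i) (C i * Y i x); lra.
  by apply: le_trans (ler_normB _ _) _; have := ler_normD (Bw i) (C i * Y i x); lra.
have [ext hext] := choice (fun i =>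
  locally_lipschitz_extension D0 cD Dab (hM i) (cT i)).
(* Clamping keeps the corrected lengths nonnegative, does nothing on [D] when [k] holds, and gives 0
   otherwise, since then [q = 0]. *)
pose psi (i : bool) x := if i then clamp (q x / 2) (ext true x) else ext false x.
have q2lip x y : `|q x / 2 - q y / 2| <= Lq * `|x - y|.
  rewrite -mulrBl normrM [`|2^-1|]gtr0_norm ?invr_gt0 //.
  by have := lq x y; have := normr_ge0 (q x - q y); lra.
have psi_cont i : cont_on a b (psi i).
  case: i; last by have [] := hext false.
  have [_ _ ce _] := hext true.
  have cq : cont_on a b (fun x => q x / 2) by apply: cont_on_lip q2lip.
  apply: (cont_onD cq ce) => x y.
  exact: clamp_sub.
have psi_lip m : exists2 L, 0 <= L & forall i x y, far D a b m x -> far D a b m y ->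
    `|psi i x - psi i y| <= L * `|x - y|.
  have [_ _ _ /(_ m)[L1 L10 hL1]] := hext false.
  have [_ _ _ /(_ m)[L2 L20 hL2]] := hext true.
  exists (L1 + L2 + Lq); first by rewrite !addr_ge0.
  move=> i x y fx fy; have := hL1 x y fx fy; have := hL2 x y fx fy.
  have := mulr_ge0 L10 (normr_ge0 (x - y)); have := mulr_ge0 L20 (normr_ge0 (x - y)).
  have := mulr_ge0 Lq0 (normr_ge0 (x - y)); have := q2lip x y.
  case: i => /=; last by lra.
  by have := clamp_sub (q x / 2) (ext true x) (q y / 2) (ext true y); lra.
have psi_small x : a <= x <= b -> `|psi true x| <= q x / 2.
  move=> xab; have [/andP[q0 _]] := hq x xab; rewrite ler_norml.
  by apply: clamp_bounds; lra.
have psi_zero : ~~ k -> forall x, a <= x <= b -> psi true x = 0.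
  move=> nk x xab; have := psi_small x xab; rewrite (q_zero nk) mul0r normr_le0.
  by move/eqP.
have psiD i x : D x -> ~~ i || k -> psi i x = T i x.
  move=> Dx; have [eD _ _ _] := hext i; case: i eD => eD kk; last exact: eD.
  rewrite /psi /= eD //; apply: clamp_id.
  have [q1 w1 z1] := hJ x (DJ x Dx) kk.
  have /andP[y0 y1] := Y01 true x.
  have cy : 0 <= c * Y true x <= c by rewrite mulr_ge0 ?ler_piMr // ltW.
  move: w1 z1; rewrite /T /= !ler_norml; case: ifP => _ /andP[? ?] /andP[? ?]; lra.
(* Both summands are covered: [w] with [psi] and [z] with [- psi], where [b0] names the half of [D]
   on which the coded values appear. *)
have main v phi b0 (A : R) : good_on (seg a b) xpred0 v ->
    (forall x, a <= x <= b -> q x / 2 <= v true x) ->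
    (forall i, cont_on a b (phi i)) ->
    (forall m, exists2 L, 0 <= L & forall i x y, far D a b m x -> far D a b m y ->
      `|phi i x - phi i y| <= L * `|x - y|) ->
    (forall x, a <= x <= b -> `|phi true x| <= q x / 2) ->
    (~~ k -> forall x, a <= x <= b -> phi true x = 0) ->
    (forall i x, D x -> side x = b0 -> ~~ i || k ->
      phi i x = (if i then A else 0) + C i * Y i x - v i x) ->
    Dbeta a b (s + 1 + k%:R) (ivf (fun i x => v i x + phi i x)).
  move=> gv vq cphi phi_lip phi_small phi_zero phiD.
  apply: (@Dbeta_ivf R a b D _ s k A c) => //.
  - move=> x xab; have := vq x xab; have := phi_small x xab.
    by rewrite ler_norml => /andP[? ?]; lra.
  - move=> i; apply: cont_onD (good_on_cont i gv) (cphi i) _ => x y.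
    by rewrite opprD addrACA; exact: ler_normD.
  - move=> m; have [L L0 hL] := phi_lip m.
    by apply: good_onD L0 hL; apply: good_on_sub gv => // x [].
  - apply: (good_on_sub Dab _ gv) => -[] // nk x Dx.
    by rewrite phi_zero ?addr0 //; exact: Dab.
  move=> eta /(lowD b0)[K K0 [p [hp1 hp2]]]; exists K => //; exists p; split => //.
  move=> y0 y1 y2 h0 h1 h2; have [Dp sp e1 e2] := hp1 _ _ _ h0 h1 h2; split => //.
    by rewrite phiD // e1 /C; lra.
  by move=> kk; rewrite phiD // e2 /C; lra.
exists (ivf (fun i x => w i x + psi i x)), (ivf (fun i x => z i x - psi i x)); split.
  apply: (main w psi false Aw) => // [x xab|i x Dx sx ik].
    by have [_ h _] := wz true x xab.
  by rewrite psiD // /T sx; case: i ik => _; rewrite /Bw; lra.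
split.
  apply: (main z (fun i x => - psi i x) true Az) => //.
  - by move=> x xab; have [_ _ h] := wz true x xab.
  - by move=> i x xab e e0; have [d d0 hd] := psi_cont i x xab e e0; exists d => // y yab xy;
      rewrite -opprD normrN; exact: hd.
  - move=> m; have [L L0 hL] := psi_lip m; exists L => // i x y fx fy.
    by rewrite -opprD normrN; exact: hL.
  - by move=> x xab; rewrite normrN; exact: psi_small.
  - by move=> nk x xab; rewrite psi_zero // oppr0.
  - move=> i x Dx sx ik.
    by rewrite psiD // /T sx; case: i ik => _; rewrite /Bz; lra.
move=> x xab; rewrite fF //.
have [e1 _ _] := wz false x xab; have [e2 u1 u2] := wz true x xab.
have := psi_small x xab; rewrite ler_norml => /andP[p1 p2].
rewrite /= in u1 u2; rewrite /ivf oplus_seg; [|lra|lra].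
by congr seg; lra.
Qed.
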